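(* Let $\mathsf P\subset\mathbb R^m$ be a $(\mu,\epsilon)$-net, $0<\rho_0\le\mu/4$, and $\mathsf P'$ a $\rho_0\epsilon$-perturbation of $\mathsf P$; set $\epsilon'=(1+\rho_0)\epsilon$, $\mu'=(\mu-2\rho_0)/(1+\rho_0)$. Let $0<\Gamma_0\le1$ and $\delta_0\ge0$ satisfy $\delta_0\le\Gamma_0^{m+1}$ and $\Gamma_0\le\frac{2\mu^2}{75}$. Suppose there is no simplex $\tau\subseteq\mathsf P'$ satisfying all of the following: (P1) $\tau$ has the $\alpha_0$-hoop property with $\alpha_0=2(16/\mu)^3\Gamma_0$; (P2) $R(\tau_p)<2\epsilon$ for all $p\in\tau$; (P3) $L(\tau)<\frac52\big(1+\frac12\delta_0\mu\big)\epsilon$; (P4) every facet of $\tau$ is $\Gamma_0$-good. Then $\mathsf P'$ contains no forbidden configuration (with parameters $\mu',\epsilon',\delta_0,\Gamma_0$), and consequently every $m$-simplex of $\mathrm{Del}_{D_{\epsilon'}}(\mathsf P')$ is $\Gamma_0$-good and $\delta$-protected, with $\delta=\delta_0\mu'\epsilon'$.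
   Context: Let $d(x,X)$ denote Euclidean distance from a point to a set; $B(c,r)$ is the open ball. For a finite $\mathsf P\subset\mathbb R^m$ and $\epsilon>0$, $\mathsf P$ is $\epsilon$-dense if $d(x,\mathsf P\cup\partial\,\mathrm{conv}(\mathsf P))<\epsilon$ for every $x\in\mathrm{conv}(\mathsf P)$; it is $\mu\epsilon$-separated if $\|p-q\|\ge\mu\epsilon$ for all distinct $p,q\in\mathsf P$. For $0<\mu\le1$, $\mathsf P$ is a $(\mu,\epsilon)$-net if it is $\epsilon$-dense and $\mu\epsilon$-separated. $D_\epsilon(\mathsf P)=\{x\in\mathrm{conv}(\mathsf P): d(x,\partial\,\mathrm{conv}(\mathsf P))\ge\epsilon\}$. A $\rho_0\epsilon$-perturbation of $\mathsf P$ is a bijection $\zeta:\mathsf P\to\mathsf P'\subset\mathbb R^m$ with $\|\zeta(p)-p\|\le\rho_0\epsilon$ for all $p$. A simplex is a nonempty finite subset $\sigma\subset\mathbb R^m$ (vertices need not be affinely independent); $\dim\sigma=|\sigma|-1$; faces are nonempty subsets; facets are faces of dimension $\dim\sigma-1$. For $p\in\sigma$, $\sigma_p=\sigma\setminus\{p\}$. $L(\sigma)$ is the largest distance between vertices. Altitude $D(p,\sigma)=d(p,\mathrm{aff}(\sigma_p))$. Thickness of a $j$-simplex: $\Upsilon(\sigma)=1$ if $j=0$, else $\min_{p}D(p,\sigma)/(jL(\sigma))$. $\sigma$ is $\Gamma_0$-good if every $j$-face $\sigma^j$ satisfies $\Upsilon(\sigma^j)\ge\Gamma_0^j$; $\Gamma_0$-bad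 otherwise; a $\Gamma_0$-flake is a $\Gamma_0$-bad simplex whose proper faces are all $\Gamma_0$-good. A circumscribing ball of $\sigma$ is an open ball whose boundary contains all vertices of $\sigma$. If one exists, the circumcentre $c(\sigma)$ and circumradius $R(\sigma)$ are the centre and radius of the smallest one (write $R(\sigma)<\infty$); otherwise $R(\sigma)=\infty$. The circumsphere is $S(\sigma)=\partial B(c(\sigma),R(\sigma))\cap\mathrm{aff}(\sigma)$. A Delaunay ball for finite $\mathsf P$ is an open ball $B(x,r)$ containing no point of $\mathsf P$ such that every open ball centred at $x$ containing no point of $\mathsf P$ is contained in $B(x,r)$. $\sigma\subseteq\mathsf P$ is Delaunay if its vertices lie on $\partial B$ for some Delaunay ball $B$. $\mathrm{Del}_{D_\epsilon}(\mathsf P)$ is the set of Delaunay simplices having a Delaunay ball centred in $D_\epsilon(\mathsf P)$. A Delaunay simplex $\sigma$ is $\delta$-protected if it has a Delaunay ball $B$ with $d(q,\partial B)>\delta$ for all $q\in\mathsf P\setminus\sigma$. Forbidden configuration: given finite $\mathsf P'\subset\mathbb R^m$ and parameters $\mu',\epsilon'>0$, $0<\Gamma_0\le1$, $\delta_0\ge0$, a $(k+1)$-simplex $\tau\subseteq\mathsf P'$ with $k\le m$ is a forbidden configuration if it is a $\Gamma_0$-flake and there exist $p\in\tau$ and a circumscribing ball $B(C,R)$ of $\tau_p$ with $R<\epsilon'$ and $\big|\,\|p-C\|-R\,\big|\le\delta_0\mu'\epsilon'$. A simplex $\tau$ has the $\alpha_0$-hoop property ($\alpha_0>0$) if for every $p\in\tau$,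 $R(\tau_p)<\infty$ and $d(p,S(\tau_p))\le\alpha_0R(\tau_p)$. *)

(* Defs.v *)
(* Stdlib (classical real numbers R).  Points of R^m are functions
   nat -> R whose coordinates of index >= m vanish (predicate [InRm m]). *)
From Stdlib Require Import Reals List Permutation ClassicalEpsilon.
Open Scope R_scope.

Definition Vec := nat -> R.
Definition vzero : Vec := fun _ => 0.
Definition vadd (x y : Vec) : Vec := fun i => x i + y i.
Definition vsub (x y : Vec) : Vec := fun i => x i - y i.
Definition vscale (a : R) (x : Vec) : Vec := fun i => a * x i.

Definition InRm (m : nat) (x : Vec) : Prop := forall i, (m <= i)%nat -> x i = 0.

Definition sumsq (m : nat) (x : Vec) : R :=
  fold_right Rplus 0 (map (fun i => x i * x i) (seq 0 m)).
Definition norm (m : nat) (x : Vec) : R := sqrt (sumsq m x).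
Definition dist (m : nat) (x y : Vec) : R := norm m (vsub x y).

Definition veq_dec (x y : Vec) : {x = y} + {x <> y} :=
  excluded_middle_informative (x = y).
Definition drop (p : Vec) (s : list Vec) : list Vec := remove veq_dec p s.

(* Comparisons of d(x,X) = inf_{y in X} |x - y|  (inf of the empty set = +oo),
   written out literally. *)
Definition dist_lt m (x : Vec) (X : Vec -> Prop) (r : R) : Prop :=
  exists y, X y /\ dist m x y < r.
Definition dist_le m (x : Vec) (X : Vec -> Prop) (r : R) : Prop :=
  forall e, 0 < e -> exists y, X y /\ dist m x y < r + e.
Definition dist_ge m (x : Vec) (X : Vec -> Prop) (r : R) : Prop :=
  forall y, X y -> r <= dist m x y.
Definition dist_gt m (x : Vec) (X : Vec -> Prop) (r : R) : Prop :=
  exists e, 0 < e /\ forall y, X y -> r + e <= dist m x y.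

Definition ball m (c : Vec) (r : R) : Vec -> Prop :=
  fun y => InRm m y /\ dist m c y < r.
Definition bdry m (A : Vec -> Prop) : Vec -> Prop :=
  fun x => InRm m x /\ forall r, 0 < r ->
    (exists y, InRm m y /\ dist m x y < r /\ A y) /\
    (exists z, InRm m z /\ dist m x z < r /\ ~ A z).

Definition lincomb (lam : list R) (s : list Vec) : Vec :=
  fold_right (fun av acc => vadd (vscale (fst av) (snd av)) acc) vzero (combine lam s).
Definition aff (s : list Vec) : Vec -> Prop :=
  fun x => exists lam : list R, length lam = length s /\
    fold_right Rplus 0 lam = 1 /\ x = lincomb lam s.
Definition conv (s : list Vec) : Vec -> Prop :=
  fun x => exists lam : list R, length lam = length s /\ Forall (fun a => 0 <= a) lam /\
    fold_right Rplus 0 lam = 1 /\ x = lincomb lam s.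

Definition finite_set m (P : list Vec) : Prop := NoDup P /\ Forall (InRm m) P.

Definition eps_dense m (P : list Vec) (eps : R) : Prop :=
  forall x, conv P x -> dist_lt m x (fun y => In y P \/ bdry m (conv P) y) eps.
Definition separated m (P : list Vec) (d : R) : Prop :=
  forall p q, In p P -> In q P -> p <> q -> d <= dist m p q.
Definition net m (P : list Vec) (mu eps : R) : Prop :=
  finite_set m P /\ 0 < eps /\ 0 < mu /\ mu <= 1 /\
  eps_dense m P eps /\ separated m P (mu * eps).

Definition D_eps m (P : list Vec) (eps : R) : Vec -> Prop :=
  fun x => conv P x /\ dist_ge m x (bdry m (conv P)) eps.

Definition perturbation m (P P' : list Vec) (rho0 eps : R) : Prop :=
  finite_set m P' /\ exists zeta : Vec -> Vec,
    Permutation P' (map zeta P) /\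
    forall p, In p P -> dist m (zeta p) p <= rho0 * eps.

Definition simplex (s : list Vec) : Prop := s <> nil /\ NoDup s.
Definition face (s f : list Vec) : Prop := simplex f /\ incl f s.
Definition facet (s f : list Vec) : Prop := face s f /\ length f = (length s - 1)%nat.

Definition Lmax m (s : list Vec) : R :=
  fold_right Rmax 0 (flat_map (fun p => map (fun q => dist m p q) s) s).

(* Upsilon(s) >= t, where for a j-simplex (j = length s - 1):
   Upsilon = 1 if j = 0, else min_p D(p,s)/(j L(s)),  D(p,s) = d(p, aff(s_p)). *)
Definition thick_ge m (s : list Vec) (t : R) : Prop :=
  (length s = 1%nat -> t <= 1) /\
  ((2 <= length s)%nat -> forall p, In p s ->
     dist_ge m p (aff (drop p s)) (t * INR (length s - 1) * Lmax m s)).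

Definition good m (Gam : R) (s : list Vec) : Prop :=
  forall f, face s f -> thick_ge m f (Gam ^ (length f - 1)).
Definition flake m (Gam : R) (s : list Vec) : Prop :=
  ~ good m Gam s /\
  forall f, face s f -> (length f < length s)%nat -> good m Gam f.

Definition circ_ball m (s : list Vec) (c : Vec) (r : R) : Prop :=
  InRm m c /\ 0 < r /\ forall v, In v s -> bdry m (ball m c r) v.
(* (c,r) is a smallest circumscribing ball: c = c(s), r = R(s) < oo *)
Definition circ_min m (s : list Vec) (c : Vec) (r : R) : Prop :=
  circ_ball m s c r /\ forall c' r', circ_ball m s c' r' -> r <= r'.
Definition circsphere m (s : list Vec) (c : Vec) (r : R) : Vec -> Prop :=
  fun x => bdry m (ball m c r) x /\ aff s x.

Definition hoop m (alpha0 : R) (tau : list Vec) : Prop :=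
  forall p, In p tau -> exists c r, circ_min m (drop p tau) c r /\
    dist_le m p (circsphere m (drop p tau) c r) (alpha0 * r).

Definition forbidden m (P' : list Vec) (mu' eps' Gam delta0 : R) (tau : list Vec) : Prop :=
  simplex tau /\ incl tau P' /\
  (exists k : nat, (k <= m)%nat /\ length tau = (k + 2)%nat) /\
  flake m Gam tau /\
  exists p C Rad, In p tau /\ circ_ball m (drop p tau) C Rad /\ Rad < eps' /\
    Rabs (dist m p C - Rad) <= delta0 * mu' * eps'.

Definition del_ball m (P : list Vec) (c : Vec) (r : R) : Prop :=
  InRm m c /\ (forall q, In q P -> ~ ball m c r q) /\
  forall r', (forall q, In q P -> ~ ball m c r' q) ->
    forall y, ball m c r' y -> ball m c r y.
Definition del_ball_of m (P s : list Vec) (c : Vec) (r : R) : Prop :=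
  del_ball m P c r /\ forall v, In v s -> bdry m (ball m c r) v.
Definition Del_D m (P : list Vec) (eps : R) (s : list Vec) : Prop :=
  simplex s /\ incl s P /\ exists c r, del_ball_of m P s c r /\ D_eps m P eps c.
Definition protected m (P : list Vec) (delta : R) (s : list Vec) : Prop :=
  exists c r, del_ball_of m P s c r /\
    forall q, In q P -> ~ In q s -> dist_gt m q (bdry m (ball m c r)) delta.

(* Main.v *)
Require Import Defs.
From Stdlib Require Import Reals List Permutation ClassicalEpsilon.
From Stdlib Require Import Lra Lia Classical FunctionalExtensionality.
(* [Reals] also exports a [dist]. *)
Require Import Defs.
Open Scope R_scope.

(** A forbidden configuration [tau] satisfies (P1)-(P4). (P3) and (P4) are immediate. Since
    [tau] is a flake, some vertex [x] is very close to the affine hull of the others; as the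
    facets are thick, exchanging [x] for any vertex [q] in the affine relation shows that [q]
    is within [36 Gam eps / mu] of [aff (drop q tau)]. A circumscribing ball of
    [drop p tau] that almost passes through [p] can be moved by [O(Gam eps)] to a
    circumscribing ball of any other facet [drop q tau], again because that facet is thick;
    this ball almost passes through [q]. Projecting its centre to [aff (drop q tau)] gives the
    circumcentre, and the two estimates together place [q] close to the circumsphere.

    For the consequence, a Delaunay ball centred in [D_eps'(P')] has radius less than [eps']:
    otherwise a hyperplane separating a point from [conv P] could be shifted to separate
    a nearby point from [conv P']. A minimal bad face of a Delaunay [m]-simplex [s], or of
    [q :: s] when [q] violates the protection (these [m + 2] points are affinely dependent),
    is then a forbidden configuration. *)


Ltac vec :=
  apply functional_extensionality; intro; unfold vadd, vsub, vscale, vzero.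

(** * Inner product and distance *)

(** [sumsq m x] unfolds to [dot m x x], so facts about [norm] reduce to bilinear algebra without a
    rewriting lemma. *)
Definition dot (m : nat) (x y : Vec) : R :=
  fold_right Rplus 0 (map (fun i => x i * y i) (seq 0 m)).

Lemma fold_sum_lin (f g h : nat -> R) a l :
  (forall i, h i = f i + a * g i) ->
  fold_right Rplus 0 (map h l) =
  fold_right Rplus 0 (map f l) + a * fold_right Rplus 0 (map g l).
Proof. intros E; induction l; simpl; [ring | rewrite E, IHl; ring]. Qed.

Lemma dot_sym m x y : dot m x y = dot m y x.
Proof.
  unfold dot; f_equal; apply map_ext; intro; ring.
Qed.

Lemma dot_axpy m a x y z : dot m (vadd x (vscale a y)) z = dot m x z + a * dot m y z.
Proof. apply fold_sum_lin; intro; unfold vadd, vscale; ring. Qed.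

Lemma dot_zerol m x : dot m vzero x = 0.
Proof.
  unfold dot, vzero; induction (seq 0 m); simpl; [easy | rewrite IHl; ring].
Qed.

Lemma dot_addl m x y z : dot m (vadd x y) z = dot m x z + dot m y z.
Proof.
  replace (vadd x y) with (vadd x (vscale 1 y)) by (vec; ring).
  rewrite dot_axpy; ring.
Qed.

Lemma dot_subl m x y z : dot m (vsub x y) z = dot m x z - dot m y z.
Proof.
  replace (vsub x y) with (vadd x (vscale (-1) y)) by (vec; ring).
  rewrite dot_axpy; ring.
Qed.

Lemma dot_scalel m a x z : dot m (vscale a x) z = a * dot m x z.
Proof.
  replace (vscale a x) with (vadd vzero (vscale a x)) by (vec; ring).
  rewrite dot_axpy, dot_zerol; ring.
Qed.

Lemma dot_addr m x y z : dot m z (vadd x y) = dot m z x + dot m z y.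
Proof. rewrite !(dot_sym m z); apply dot_addl. Qed.

Lemma dot_subr m x y z : dot m z (vsub x y) = dot m z x - dot m z y.
Proof. rewrite !(dot_sym m z); apply dot_subl. Qed.

Lemma dot_scaler m a x z : dot m z (vscale a x) = a * dot m z x.
Proof. rewrite !(dot_sym m z); apply dot_scalel. Qed.

Lemma dot_zeror m x : dot m x vzero = 0.
Proof. rewrite dot_sym; apply dot_zerol. Qed.

Ltac dots :=
  repeat rewrite ?dot_addl, ?dot_subl, ?dot_scalel, ?dot_addr, ?dot_subr, ?dot_scaler.

Lemma dot_pos m x : 0 <= dot m x x.
Proof.
  unfold dot; induction (seq 0 m); simpl; [lra | nra].
Qed.

Lemma dot_self_eq0 m x : dot m x x = 0 -> forall i, (i < m)%nat -> x i = 0.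
Proof.
  intros H i Hi.
  assert (G : forall l, fold_right Rplus 0 (map (fun i => x i * x i) l) = 0 ->
            In i l -> x i = 0).
  { assert (N : forall l, 0 <= fold_right Rplus 0 (map (fun i => x i * x i) l))
      by (induction l; simpl; [lra | nra]).
    induction l as [|j l IH]; simpl; [easy|]; intros E [->|K].
    - specialize (N l); nra.
    - apply IH; trivial; specialize (N l); nra. }
  apply (G _ H), in_seq; lia.
Qed.

(** The quadratic [Q] in [t] is the squared length of [x + t y]; it is evaluated at its
    minimiser. *)
Lemma cauchy_schwarz m x y : dot m x y * dot m x y <= dot m x x * dot m y y.
Proof.
  assert (Q : forall t, 0 <= dot m x x + 2 * t * dot m x y + t * t * dot m y y).
  { intro t; pose proof (dot_pos m (vadd x (vscale t y))) as H.
    revert H; dots; rewrite (dot_sym m y x); intro; nra. }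
  pose proof (dot_pos m x); destruct (dot_pos m y) as [Hy|Hy].
  - specialize (Q (- dot m x y / dot m y y)).
    assert (E : dot m x x + 2 * (- dot m x y / dot m y y) * dot m x y +
      - dot m x y / dot m y y * (- dot m x y / dot m y y) * dot m y y =
      (dot m x x * dot m y y - dot m x y * dot m x y) / dot m y y) by (field; lra).
    rewrite E in Q.
    apply Rmult_le_compat_r with (r := dot m y y) in Q; [|lra].
    unfold Rdiv in Q; rewrite Rmult_assoc, Rinv_l in Q; lra.
  - rewrite <- Hy in *.
    destruct (Req_dec (dot m x y) 0) as [->|N]; [lra|].
    specialize (Q (- (dot m x x + 1) / (2 * dot m x y))).
    (* With [dot m y y = 0] the quadratic is affine in [t], and this [t] would give it the value
       [-1]. *)
    replace (2 * (- (dot m x x + 1) / (2 * dot m x y)) * dot m x y)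
      with (- (dot m x x + 1)) in Q by (field; lra).
    lra.
Qed.

Lemma norm_ge0 m x : 0 <= norm m x.
Proof. apply sqrt_pos. Qed.

Lemma norm_sqr m x : norm m x * norm m x = dot m x x.
Proof. apply sqrt_sqrt, dot_pos. Qed.

Lemma dot_le_norm m x y : dot m x y <= norm m x * norm m y.
Proof.
  pose proof (cauchy_schwarz m x y) as H; rewrite <- !norm_sqr in H.
  pose proof (Rmult_le_pos _ _ (norm_ge0 m x) (norm_ge0 m y)).
  nra.
Qed.

Lemma norm_add m x y : norm m (vadd x y) <= norm m x + norm m y.
Proof.
  pose proof (norm_ge0 m x); pose proof (norm_ge0 m y); pose proof (dot_le_norm m x y).
  pose proof (norm_sqr m (vadd x y)) as E; revert E; dots.
  rewrite (dot_sym m y x), <- !norm_sqr; intro.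
  pose proof (norm_ge0 m (vadd x y)); nra.
Qed.

Lemma norm_scale m a x : norm m (vscale a x) = Rabs a * norm m x.
Proof.
  pose proof (norm_sqr m (vscale a x)) as E; revert E; dots.
  rewrite <- norm_sqr; intro.
  pose proof (norm_ge0 m (vscale a x)); pose proof (norm_ge0 m x).
  pose proof (Rabs_pos a); pose proof (Rsqr_abs a) as A; unfold Rsqr in A.
  apply Rsqr_inj; unfold Rsqr; nra.
Qed.

Lemma dist_ge0 m x y : 0 <= dist m x y.
Proof. apply norm_ge0. Qed.

Lemma dist_sqr m x y : dist m x y * dist m x y = dot m (vsub x y) (vsub x y).
Proof. apply norm_sqr. Qed.

Lemma dist_sym m x y : dist m x y = dist m y x.
Proof.
  unfold dist; replace (vsub x y) with (vscale (-1) (vsub y x)) by (vec; ring).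
  rewrite norm_scale, Rabs_left; [ring | lra].
Qed.

Lemma dist_tri m x y z : dist m x z <= dist m x y + dist m y z.
Proof.
  unfold dist; replace (vsub x z) with (vadd (vsub x y) (vsub y z)) by (vec; ring).
  apply norm_add.
Qed.

Lemma dist_refl m x : dist m x x = 0.
Proof.
  unfold dist; replace (vsub x x) with (vscale 0 x) by (vec; ring).
  rewrite norm_scale, Rabs_R0; ring.
Qed.

Lemma dist_shift m x y z t : dist m x (vadd x (vscale t (vsub y z))) = Rabs t * dist m y z.
Proof.
  unfold dist.
  replace (vsub x (vadd x (vscale t (vsub y z)))) with (vscale (- t) (vsub y z)) by (vec; ring).
  rewrite norm_scale, Rabs_Ropp; easy.
Qed.

Lemma dist_eq0 m x y : InRm m x -> InRm m y -> dist m x y = 0 -> x = y.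
Proof.
  intros Hx Hy H.
  pose proof (dist_sqr m x y) as E; rewrite H, Rmult_0_l in E; symmetry in E.
  apply functional_extensionality; intro i.
  destruct (Nat.lt_ge_cases i m) as [L|L].
  - pose proof (dot_self_eq0 _ _ E i L) as Z; unfold vsub in Z; lra.
  - rewrite Hx, Hy; trivial.
Qed.

Lemma dist_pos m x y : InRm m x -> InRm m y -> x <> y -> 0 < dist m x y.
Proof.
  intros Hx Hy N; destruct (dist_ge0 m x y) as [H|H]; trivial.
  exfalso; apply N, (dist_eq0 m); auto.
Qed.

Lemma InRm_shift m x y z t :
  InRm m x -> InRm m y -> InRm m z -> InRm m (vadd x (vscale t (vsub y z))).
Proof.
  intros Hx Hy Hz i Hi; unfold vadd, vscale, vsub.
  rewrite Hx, Hy, Hz; trivial; ring.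
Qed.

Lemma bdry_ball_dist m c r v : bdry m (ball m c r) v -> dist m c v = r.
Proof.
  intros [Hv H].
  destruct (Rtotal_order (dist m c v) r) as [L|[E|G]]; trivial; exfalso.
  - destruct (H (r - dist m c v)) as [_ [z [Hz [D N]]]]; [lra|].
    apply N; split; trivial; pose proof (dist_tri m c v z); lra.
  - destruct (H (dist m c v - r)) as [[y [Hy [D [_ N]]]] _]; [lra|].
    pose proof (dist_tri m c y v) as T; rewrite (dist_sym m y v) in T; lra.
Qed.

(** Inside points are found by moving from [v] slightly towards the centre; since the ball is open,
    [v] is its own outside witness. *)
Lemma bdry_ball_intro m c r v :
  InRm m c -> InRm m v -> 0 < r -> dist m c v = r -> bdry m (ball m c r) v.
Proof.
  intros Hc Hv Hr E; split; trivial; intros e He; split.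
  - set (t := Rmin (1 / 2) (e / (2 * r))).
    assert (T : 0 < t <= 1 / 2 /\ t <= e / (2 * r)).
    { unfold t; repeat split; [|apply Rmin_l|apply Rmin_r].
      apply Rmin_glb_lt; [lra | apply Rdiv_lt_0_compat; lra]. }
    assert (T2 : t * r < e).
    { apply Rle_lt_trans with (e / (2 * r) * r); [nra|].
      replace (e / (2 * r) * r) with (e / 2) by (field; lra); lra. }
    exists (vadd v (vscale t (vsub c v))).
    assert (In1 : InRm m (vadd v (vscale t (vsub c v)))) by (apply InRm_shift; trivial).
    split; [|split]; trivial.
    + rewrite dist_shift, E, Rabs_pos_eq; lra.
    + split; trivial.
      replace (vadd v (vscale t (vsub c v))) with (vadd c (vscale (1 - t) (vsub v c)))
        by (vec; ring).
      rewrite dist_shift, dist_sym, E, Rabs_pos_eq; nra.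
  - exists v; split; [|split]; trivial.
    + rewrite dist_refl; trivial.
    + intros [_ N]; lra.
Qed.

(** * Affine hulls *)

Lemma lincomb_axpy t s : forall l1 l2, length l1 = length s -> length l2 = length s ->
  exists l, length l = length s /\
    fold_right Rplus 0 l = fold_right Rplus 0 l1 + t * fold_right Rplus 0 l2 /\
    lincomb l s = vadd (lincomb l1 s) (vscale t (lincomb l2 s)).
Proof.
  induction s as [|v s IH]; intros [|a l1] [|b l2]; simpl; try easy; intros H1 H2.
  - exists nil; split; [|split]; simpl; [easy | ring | vec; unfold lincomb, vzero; simpl; unfold vzero; ring].
  - destruct (IH l1 l2) as [l [L [F E]]]; try lia.
    exists (a + t * b :: l); split; [simpl; lia|split]; simpl.
    + rewrite F; ring.
    + unfold lincomb in *; simpl; rewrite E; vec; ring.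
Qed.

Lemma lincomb_zero s : lincomb (repeat 0 (length s)) s = vzero.
Proof.
  induction s as [|v s IH]; [easy|].
  unfold lincomb in *; simpl; rewrite IH; vec; ring.
Qed.

Lemma sum_repeat0 n : fold_right Rplus 0 (repeat 0 n) = 0.
Proof. induction n; simpl; [easy | rewrite IHn; ring]. Qed.

Lemma aff_in s v : In v s -> aff s v.
Proof.
  induction s as [|w s IH]; [easy|]; intros [->|H].
  - exists (1 :: repeat 0 (length s)); simpl; rewrite repeat_length, sum_repeat0.
    split; [easy|split]; [ring|].
    unfold lincomb; simpl; fold (lincomb (repeat 0 (length s)) s).
    rewrite lincomb_zero; vec; ring.
  - destruct (IH H) as [l [L [F E]]].
    exists (0 :: l); simpl; rewrite F, L; split; [easy|split]; [ring|].
    unfold lincomb in *; simpl; rewrite <- E; vec; ring.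
Qed.

Lemma aff_comb s x y z t : aff s x -> aff s y -> aff s z ->
  aff s (vadd x (vscale t (vsub y z))).
Proof.
  intros [lx [Lx [Fx ->]]] [ly [Ly [Fy ->]]] [lz [Lz [Fz ->]]].
  destruct (lincomb_axpy (-1) s ly lz Ly Lz) as [l [L [F E]]].
  destruct (lincomb_axpy t s lx l Lx L) as [l' [L' [F' E']]].
  exists l'; split; [easy|split].
  - rewrite F', F, Fx, Fy, Fz; ring.
  - rewrite E', E; vec; ring.
Qed.

(** An affine combination is reached from a base point [z] of [s] by adding the terms [a (v - z)]
    one at a time. This induction principle replaces coefficient lists in most later arguments. *)
Lemma aff_ind (s : list Vec) (Q : Vec -> Prop) :
  (forall v, In v s -> Q v) ->
  (forall w v z t, Q w -> In v s -> In z s -> Q (vadd w (vscale t (vsub v z)))) ->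
  forall x, aff s x -> Q x.
Proof.
  intros H0 H1 x [l [L [F ->]]].
  assert (exists z, In z s) as [z Hz].
  { destruct s as [|z s]; [|exists z; now left].
    destruct l; simpl in *; [lra | easy]. }
  (* For partial sums the missing weight stays on [z]; once the weights sum to 1, [z] cancels. *)
  assert (G : forall s' l, incl s' s -> length l = length s' ->
    Q (vadd z (vsub (lincomb l s') (vscale (fold_right Rplus 0 l) z)))).
  { induction s' as [|v s' IH]; intros [|a l'] I L'; try easy.
    - replace (vadd _ _) with z by (vec; unfold lincomb, vzero; simpl; unfold vzero; ring); auto.
    - specialize (IH l' (fun u h => I u (or_intror h)) ltac:(simpl in L'; lia)).
      apply (H1 _ v z a) in IH; [|apply I; now left|trivial].
      unfold lincomb in *; simpl.
      match goal with H : Q ?a |- Q ?b => replace b with a; trivial end.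
      vec; ring. }
  specialize (G s l (incl_refl s) L); rewrite F in G.
  replace (lincomb l s) with (vadd z (vsub (lincomb l s) (vscale 1 z))) by (vec; ring).
  trivial.
Qed.

Lemma aff_incl s t x : incl s t -> aff s x -> aff t x.
Proof.
  intros I; apply aff_ind.
  - intros v Hv; apply aff_in, I, Hv.
  - intros w v z a Hw Hv Hz; apply aff_comb; trivial; apply aff_in, I; trivial.
Qed.

Lemma aff_InRm m s x : Forall (InRm m) s -> aff s x -> InRm m x.
Proof.
  rewrite Forall_forall; intros H; apply aff_ind; trivial.
  intros; apply InRm_shift; auto.
Qed.

Lemma aff_cons q s z y : In z s -> aff (q :: s) y ->
  exists t w, aff s w /\ y = vadd w (vscale t (vsub q z)).
Proof.
  intros Hz; revert y; apply aff_ind.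
  - intros v [<-|Hv].
    + exists 1, z; split; [apply aff_in; trivial | vec; ring].
    + exists 0, v; split; [apply aff_in; trivial | vec; ring].
  - intros y v z' a [t [w [Hw ->]]] Hv Hz'.
    assert (D : forall v, In v (q :: s) ->
      exists b v', In v' s /\ v = vadd v' (vscale b (vsub q z))).
    { intros u [<-|Hu]; [exists 1, z | exists 0, u]; split; trivial; vec; ring. }
    destruct (D v Hv) as [b [v' [I1 ->]]], (D z' Hz') as [b' [z'' [I2 ->]]].
    exists (t + a * (b - b')), (vadd w (vscale a (vsub v' z''))); split.
    + apply aff_comb; trivial; apply aff_in; trivial.
    + vec; ring.
Qed.

Lemma dot_aff m s u c x y : (forall v, In v s -> dot m u v = c) ->
  aff s x -> aff s y -> dot m u (vsub x y) = 0.
Proof.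
  intros H.
  assert (G : forall x, aff s x -> dot m u x = c).
  { apply aff_ind; trivial.
    intros w v z t E Hv Hz; dots; rewrite E, !H; trivial; ring. }
  intros Hx Hy; dots; rewrite !G; trivial; ring.
Qed.

(** Gram-Schmidt by induction on the vertex list: project both [C] and the new vertex [v] to the
    smaller hull, then correct along [a = v - v']. *)
Lemma aff_projection m s C : s <> nil ->
  exists c, aff s c /\ forall x y, aff s x -> aff s y -> dot m (vsub C c) (vsub x y) = 0.
Proof.
  revert C; induction s as [|v s IH]; [easy|]; intros C _.
  destruct s as [|z s'].
  - exists v; split; [apply aff_in; now left|].
    intros x y Hx Hy; apply (dot_aff m (v :: nil) _ (dot m (vsub C v) v)); trivial.
    now intros u [<-|[]].
  - set (s := z :: s') in *.
    assert (Hz : In z s) by now left.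
    destruct (IH C) as [c' [Hc' Oc]]; [easy|].
    destruct (IH v) as [v' [Hv' Ov]]; [easy|].
    assert (I : forall x, aff s x -> aff (v :: s) x)
      by (intro x; apply aff_incl; intros u Hu; now right).
    set (a := vsub v v') in *.
    (* If [a] has length 0, the new vertex does not enlarge the hull and Cauchy-Schwarz allows
       [t = 0]; the vertices may thus be affinely dependent. *)
    assert (exists t, dot m (vsub (vsub C c') (vscale t a)) a = 0) as [t Ht].
    { destruct (Req_dec (dot m a a) 0) as [E|N].
      - exists 0; dots; rewrite <- dot_subl.
        pose proof (cauchy_schwarz m (vsub C c') a) as S; rewrite E in S; nra.
      - exists (dot m (vsub C c') a / dot m a a); dots; field; trivial. }
    exists (vadd c' (vscale t a)); split.
    + apply aff_comb; auto; apply aff_in; now left.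
    + replace (vsub C (vadd c' (vscale t a))) with (vsub (vsub C c') (vscale t a))
        by (vec; ring).
      set (n := vsub (vsub C c') (vscale t a)) in *.
      assert (On : forall x y, aff s x -> aff s y -> dot m n (vsub x y) = 0).
      { intros x y Hx Hy; unfold n; rewrite dot_subl, dot_scalel, Oc, Ov; trivial; ring. }
      intros x y; apply dot_aff with (c := dot m n v').
      intros u Hu.
      enough (dot m n (vsub u v') = 0) by (rewrite dot_subr in H; lra).
      destruct Hu as [<-|Hu]; trivial.
      apply On; trivial; apply aff_in; trivial.
Qed.

(** * Circumscribing balls *)

Lemma circ_ball_dist m s C r v : circ_ball m s C r -> In v s -> dist m C v = r.
Proof. intros [_ [_ H]] Hv; apply (bdry_ball_dist m), H, Hv. Qed.

Lemma circ_ball_InRm m s C r : circ_ball m s C r -> Forall (InRm m) s.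
Proof. intros [_ [_ H]]; apply Forall_forall; intros v Hv; apply (H v Hv). Qed.

Lemma circ_ball_incl m s t C r : incl s t -> circ_ball m t C r -> circ_ball m s C r.
Proof. intros I [H1 [H2 H3]]; split; [|split]; auto. Qed.

Lemma sqr_dist_diff m x y z :
  dist m x z * dist m x z - dist m y z * dist m y z =
  dot m (vsub x y) (vsub x y) + 2 * dot m (vsub x y) (vsub y z).
Proof.
  rewrite !dist_sqr; dots; rewrite (dot_sym m y x), (dot_sym m z x), (dot_sym m z y); ring.
Qed.

(** By Pythagoras, projecting [C] to [aff s] lowers the squared distance to every point of [aff s]
    by the same amount. So the foot [c] is equidistant from [s], and a point of [aff s] has the same
    power with respect to both balls. Two distinct vertices force a positive radius. *)
Lemma circ_min_exists m s C Rad x1 x2 :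
  circ_ball m s C Rad -> In x1 s -> In x2 s -> x1 <> x2 ->
  exists c r, circ_min m s c r /\ aff s c /\ 0 < r /\ r <= Rad /\
    (forall v, In v s -> dist m c v = r) /\
    forall y, aff s y ->
      dist m c y * dist m c y - r * r = dist m C y * dist m C y - Rad * Rad.
Proof.
  intros HC H1 H2 N; pose proof (circ_ball_InRm _ _ _ _ HC) as HS.
  destruct (aff_projection m s C) as [c [Ac Oc]]; [now intros -> |].
  assert (Hc : InRm m c) by exact (aff_InRm _ _ _ HS Ac).
  assert (Py : forall y, aff s y -> dist m C y * dist m C y - dist m c y * dist m c y =
    dot m (vsub C c) (vsub C c)).
  { intros y Hy; rewrite sqr_dist_diff, (Oc c y); trivial; ring. }
  assert (Ev : forall v, In v s -> dist m c v = dist m c x1).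
  { intros v Hv.
    pose proof (Py v (aff_in _ _ Hv)) as E; pose proof (Py x1 (aff_in _ _ H1)) as E1.
    rewrite (circ_ball_dist _ _ _ _ _ HC Hv) in E.
    rewrite (circ_ball_dist _ _ _ _ _ HC H1) in E1.
    apply Rsqr_inj; unfold Rsqr; try apply dist_ge0; lra. }
  assert (HS' := proj1 (Forall_forall _ _) HS).
  assert (Hr : 0 < dist m c x1).
  { destruct (dist_ge0 m c x1) as [H|H]; trivial; exfalso; apply N.
    transitivity c; [symmetry|]; apply (dist_eq0 m); auto.
    rewrite Ev; auto. }
  exists c, (dist m c x1); split; [split|].
  - split; [|split]; auto; intros; apply bdry_ball_intro; auto.
  - intros c' r' Hc'.
    (* Both [c'] and [c] are equidistant from [s], so the functional [c' - c] is constant on [s],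
       hence on [aff s], which contains [c]. Pythagoras then gives [r <= r']. *)
    assert (Z : dot m (vsub c' c) (vsub c x1) = 0).
    { apply dot_aff with (s := s) (c := dot m (vsub c' c) x1); auto using aff_in.
      intros v Hv.
      pose proof (sqr_dist_diff m c' c v) as E; pose proof (sqr_dist_diff m c' c x1) as E1.
      rewrite (circ_ball_dist _ _ _ _ _ Hc' Hv), Ev in E by trivial.
      rewrite (circ_ball_dist _ _ _ _ _ Hc' H1) in E1.
      rewrite !(dot_subr m c v), !(dot_subr m c x1) in *; lra. }
    pose proof (sqr_dist_diff m c' c x1) as E; rewrite Z in E.
    rewrite (circ_ball_dist _ _ _ _ _ Hc' H1) in E.
    pose proof (dot_pos m (vsub c' c)); destruct Hc' as [_ [Hr' _]].
    apply Rsqr_incr_0; unfold Rsqr; lra.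
  - pose proof (Py x1 (aff_in _ _ H1)) as E1.
    rewrite (circ_ball_dist _ _ _ _ _ HC H1) in E1.
    pose proof (dot_pos m (vsub C c)); destruct HC as [_ [HR _]].
    split; [trivial|split;[trivial|split;[|split;[trivial|]]]].
    + apply Rsqr_incr_0; unfold Rsqr; lra.
    + intros y Hy; specialize (Py y Hy); lra.
Qed.

(** The point [z] is the radial projection of [y] from [c], at distance [||c - y| - r|]. Equality of
    powers turns this into the known deviation of [y] from the sphere of radius [Rad]; multiplying
    by [r] avoids a division. The bound on [dist m x1 x2] serves to bound [r] from below. *)
Lemma near_circsphere m s C Rad x1 x2 q y h d :
  circ_ball m s C Rad -> In x1 s -> In x2 s -> x1 <> x2 ->
  aff s y -> dist m q y <= h -> Rabs (dist m q C - Rad) <= d ->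
  exists c r, circ_min m s c r /\ 0 < r /\ r <= Rad /\ dist m x1 x2 <= 2 * r /\
    exists z, circsphere m s c r z /\
      dist m q z * r <= h * r + (h + d) * (2 * Rad + h + d).
Proof.
  intros HC H1 H2 N Hy Hq Hd.
  destruct (circ_min_exists m s C Rad x1 x2) as [c [r [Hm [Ac [Hr [HrR [Ev Py]]]]]]]; trivial.
  assert (HS := circ_ball_InRm _ _ _ _ HC); assert (HS' := proj1 (Forall_forall _ _) HS).
  assert (Hc : InRm m c) by exact (aff_InRm _ _ _ HS Ac).
  exists c, r; split; [|split;[|split;[|split]]]; trivial.
  { pose proof (dist_tri m x1 c x2) as T.
    rewrite (dist_sym m x1 c), !Ev in T; trivial; lra. }
  assert (exists z, circsphere m s c r z /\ dist m y z = Rabs (dist m c y - r))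
    as [z [Hz Dz]].
  { destruct (dist_ge0 m c y) as [P|Z].
    - assert (E : vadd y (vscale (r / dist m c y - 1) (vsub y c)) =
                  vadd c (vscale (r / dist m c y) (vsub y c))) by (vec; ring).
      exists (vadd y (vscale (r / dist m c y - 1) (vsub y c))); split; [split|].
      + rewrite E; apply bdry_ball_intro; trivial.
        * apply InRm_shift; trivial; exact (aff_InRm _ _ _ HS Hy).
        * rewrite dist_shift, (dist_sym m y c), Rabs_pos_eq; [field; lra|].
          apply Rlt_le, Rdiv_lt_0_compat; lra.
      + apply aff_comb; trivial.
      + rewrite dist_shift, (dist_sym m y c), Rabs_minus_sym.
        rewrite <- (Rabs_pos_eq (dist m c y)) at 2 by lra.
        rewrite <- Rabs_mult; f_equal; field; lra.
    (* Here [y] is the centre and has no radial projection, but any vertex is at distance exactly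
       [r]. *)
    - exists x1; split; [split|].
      + apply bdry_ball_intro; auto.
      + apply aff_in; trivial.
      + rewrite <- (dist_eq0 m c y); auto; [|exact (aff_InRm _ _ _ HS Hy)].
        rewrite Ev, dist_refl by trivial; rewrite Rabs_left; lra. }
  exists z; split; trivial.
  pose proof (dist_tri m q y z) as T; rewrite Dz in T.
  pose proof (dist_ge0 m c y); pose proof (dist_ge0 m C y); pose proof (dist_ge0 m q y).
  assert (B : Rabs (dist m C y - Rad) <= h + d).
  { pose proof (dist_tri m C q y); pose proof (dist_tri m C y q).
    rewrite (dist_sym m y q), (dist_sym m C q) in *.
    apply Rabs_le; revert Hd; unfold Rabs; destruct (Rcase_abs _); lra. }
  assert (K : Rabs (dist m c y - r) * r <= (h + d) * (2 * Rad + h + d)).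
  { apply Rle_trans with (Rabs (dist m c y - r) * (dist m c y + r)).
    - apply Rmult_le_compat_l; [apply Rabs_pos | lra].
    - rewrite <- (Rabs_pos_eq (dist m c y + r)) by lra; rewrite <- Rabs_mult.
      replace ((dist m c y - r) * (dist m c y + r))
        with ((dist m C y - Rad) * (dist m C y + Rad))
        by (specialize (Py y Hy); lra).
      rewrite Rabs_mult, (Rabs_pos_eq (_ + _)) by lra.
      apply Rmult_le_compat; try apply Rabs_pos; try lra.
      revert B; unfold Rabs; destruct (Rcase_abs _); lra. }
  nra.
Qed.

(* Moving the centre orthogonally to [aff s] keeps it equidistant from [s]. *)
Lemma circ_ball_cons m s p C Rad d A :
  s <> nil -> InRm m p -> circ_ball m s C Rad ->
  0 < A -> dist_ge m p (aff s) A -> Rabs (dist m p C - Rad) <= d ->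
  exists C' Rad', circ_ball m (p :: s) C' Rad' /\
    2 * A * dist m C C' <= d * (2 * Rad + d).
Proof.
  intros Hs Hp HC HA Hge Hd.
  assert (HS := circ_ball_InRm _ _ _ _ HC); assert (HS' := proj1 (Forall_forall _ _) HS).
  destruct (aff_projection m s p) as [p' [Ap' Op']]; trivial.
  assert (Hp' : InRm m p') by exact (aff_InRm _ _ _ HS Ap').
  pose proof (Hge p' Ap') as HD.
  pose proof (dist_sqr m p p') as HDD.
  set (a := vsub p p') in *.
  (* Every [x] in [s] satisfies [a . (p - x) = a . a], so equating the squared distances of
     [C + u a] to [p] and to [x] is linear in [u], with this solution. *)
  set (u := (dist m p C * dist m p C - Rad * Rad) / (2 * dot m a a)).
  set (C' := vadd C (vscale u a)).
  destruct s as [|x0 s0]; [easy|]; set (s := x0 :: s0) in *.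
  assert (Hx0 : In x0 s) by now left.
  assert (Hpos : 0 < dot m a a) by nra.
  assert (HC' : InRm m C') by (apply InRm_shift; trivial; exact (proj1 HC)).
  assert (E : forall x, In x s -> dist m C' x = dist m C' p).
  { intros x Hx.
    assert (D1 : dot m a (vsub p x) = dot m a a).
    { replace (vsub p x) with (vadd a (vsub p' x)) by (unfold a; vec; ring).
      rewrite dot_addr, (Op' p' x); auto using aff_in; ring. }
    pose proof (sqr_dist_diff m C' C x) as E1; pose proof (sqr_dist_diff m C' C p) as E2.
    rewrite (circ_ball_dist _ _ _ _ _ HC Hx) in E1.
    replace (vsub C' C) with (vscale u a) in * by (unfold C'; vec; ring).
    revert E1 E2 D1; dots; intros E1 E2 D1.
    assert (U : 2 * u * dot m a a = dist m C p * dist m C p - Rad * Rad)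
      by (unfold u; rewrite (dist_sym m C p); field; lra).
    apply Rsqr_inj; unfold Rsqr; try apply dist_ge0.
    assert (dot m a p = dot m a x + dot m a a) by lra.
    nra. }
  exists C', (dist m C' p); split.
  - assert (P : 0 < dist m C' p).
    { destruct (dist_ge0 m C' p) as [H|H]; trivial; exfalso.
      assert (p = x0).
      { transitivity C'; [symmetry|]; apply (dist_eq0 m); auto.
        rewrite E; auto. }
      specialize (Hge x0 (aff_in _ _ Hx0)).
      subst x0; rewrite dist_refl in Hge; lra. }
    split; [|split]; trivial; intros v [<-|Hv]; apply bdry_ball_intro; auto.
  - unfold C', a; rewrite dist_shift; unfold u, Rdiv.
    rewrite Rabs_mult, Rabs_inv, (Rabs_pos_eq (2 * dot m a a)) by lra.
    replace (dist m p C * dist m p C - Rad * Rad)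
      with ((dist m p C - Rad) * (dist m p C + Rad)) by ring.
    destruct HC as [_ [HR _]]; pose proof (dist_ge0 m p C).
    rewrite Rabs_mult, (Rabs_pos_eq (_ + _)), <- HDD by lra.
    assert (K : Rabs (dist m p C - Rad) * (dist m p C + Rad) <= d * (2 * Rad + d)).
    { apply Rmult_le_compat; try apply Rabs_pos; try lra.
      revert Hd; unfold Rabs; destruct (Rcase_abs _); lra. }
    set (X := Rabs (dist m p C - Rad) * (dist m p C + Rad)) in *.
    assert (0 <= X) by (apply Rmult_le_pos; [apply Rabs_pos | lra]).
    set (D := dist m p p') in *.
    (* The centre moves by [X / (2 D)], where the altitude [D] is at least [A]. *)
    replace (2 * A * (X * / (2 * (D * D)) * D)) with (X * (A / D)) by (field; lra).
    assert (0 <= A / D <= 1).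
    { split; [apply Rlt_le, Rdiv_lt_0_compat; lra|].
      apply Rmult_le_reg_r with D; [lra|]; unfold Rdiv; rewrite Rmult_assoc, Rinv_l; lra. }
    nra.
Qed.

(** * Flakes *)

Lemma in_drop p x s : In x (drop p s) <-> In x s /\ x <> p.
Proof.
  unfold drop; split; [apply in_remove|].
  intros [H N]; apply in_in_remove; trivial.
Qed.

Lemma NoDup_drop p s : NoDup s -> NoDup (drop p s).
Proof.
  unfold drop; induction 1; simpl; [constructor|].
  destruct (veq_dec p x); trivial; constructor; trivial.
  intro K; apply in_remove in K; tauto.
Qed.

Lemma length_drop p s : NoDup s -> In p s -> length s = S (length (drop p s)).
Proof.
  unfold drop; induction 1 as [|x s Nx Hs IH]; simpl; [easy|]; intros [->|H].
  - destruct (veq_dec p p) as [_|]; [|easy].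
    rewrite notin_remove; trivial.
  - destruct (veq_dec p x) as [->|]; [easy|]; simpl; rewrite <- IH; trivial.
Qed.

Lemma Lmax_ge m s p q : In p s -> In q s -> dist m p q <= Lmax m s.
Proof.
  intros Hp Hq; unfold Lmax.
  assert (G : forall l a, In a l -> a <= fold_right Rmax 0 l).
  { induction l as [|b l IH]; simpl; [easy|]; intros a [->|H]; [apply Rmax_l|].
    apply Rle_trans with (2 := Rmax_r _ _); auto. }
  apply G, in_flat_map; exists p; split; trivial.
  apply in_map_iff; exists q; split; trivial.
Qed.

Lemma Lmax_le m s M : 0 <= M -> (forall p q, In p s -> In q s -> dist m p q <= M) ->
  Lmax m s <= M.
Proof.
  intros H0 H; unfold Lmax.
  assert (G : forall l, (forall a, In a l -> a <= M) -> fold_right Rmax 0 l <= M).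
  { induction l as [|b l IH]; simpl; trivial; intros K; apply Rmax_lub; auto. }
  apply G; intros a Ha; apply in_flat_map in Ha as [p [Hp Ha]].
  apply in_map_iff in Ha as [q [<- Hq]]; auto.
Qed.

Lemma Lmax_ge0 m s : 0 <= Lmax m s.
Proof.
  unfold Lmax; induction (flat_map _ s); simpl; [lra|].
  apply Rle_trans with (1 := IHl), Rmax_r.
Qed.

Lemma Lmax_incl m s t : incl s t -> Lmax m s <= Lmax m t.
Proof.
  intros I; apply Lmax_le; [apply Lmax_ge0|]; intros; apply Lmax_ge; auto.
Qed.

Lemma good_face m Gam s f : face s f -> good m Gam s -> good m Gam f.
Proof.
  intros [_ I] H g [Hg Ig]; apply H; split; trivial; intros x Hx; auto.
Qed.

Lemma face_refl s : simplex s -> face s s.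
Proof. intros H; split; trivial; apply incl_refl. Qed.

(** Descent on the number of vertices: a bad face with the fewest vertices is a flake. *)
Lemma flake_exists m Gam s : simplex s -> ~ good m Gam s ->
  exists f, face s f /\ flake m Gam f.
Proof.
  remember (length s) as n eqn:En; revert s En.
  induction n as [n IH] using (well_founded_induction Wf_nat.lt_wf); intros s En Hs Hb.
  destruct (classic (exists f, face s f /\ (length f < length s)%nat /\ ~ good m Gam f))
    as [[f [Ff [Lf Bf]]]|N].
  - destruct (IH (length f)) with (s := f) as [g [[Hg Ig] Fg]]; trivial; [lia|apply Ff|].
    exists g; split; trivial; split; trivial; intros x Hx; apply Ff; auto.
  - exists s; split; [apply face_refl; trivial|]; split; trivial.
    intros f Ff Lf; apply NNPP; intro; apply N; eauto.
Qed.

(** Proper faces are thick, so the face violating goodness has all the vertices of [tau]. A single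
    vertex has thickness 1 and cannot violate it. *)
Lemma flake_bad_vertex m Gam tau : 0 < Gam -> simplex tau -> flake m Gam tau ->
  (2 <= length tau)%nat /\ exists x y, In x tau /\ aff (drop x tau) y /\
    dist m x y < Gam ^ (length tau - 1) * INR (length tau - 1) * Lmax m tau.
Proof.
  intros HG [Hn Hd] [Hbad Hprop].
  assert (exists f, face tau f /\ ~ thick_ge m f (Gam ^ (length f - 1))) as [f [Ff Bf]].
  { apply NNPP; intro K; apply Hbad; intros f Ff; apply NNPP; intro; apply K; eauto. }
  destruct Ff as [Sf If].
  assert (Lf : length f = length tau).
  { pose proof (NoDup_incl_length (proj2 Sf) If).
    destruct (Nat.eq_dec (length f) (length tau)); trivial.
    exfalso; apply Bf; apply (Hprop f); [split; trivial|lia|apply face_refl; trivial]. }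
  (* As a list [f] may order the vertices differently, so altitude and diameter are transferred
     through inclusions. *)
  assert (Jf : incl tau f) by (apply NoDup_length_incl; trivial; [apply Sf|lia]).
  rewrite Lf in Bf.
  assert (H2 : (2 <= length tau)%nat).
  { destruct tau as [|x [|x' tau]]; simpl; [easy| |lia].
    exfalso; apply Bf; split; [simpl; lra | simpl in Lf; lia]. }
  split; trivial.
  assert (exists x, In x f /\ ~ dist_ge m x (aff (drop x f))
     (Gam ^ (length tau - 1) * INR (length f - 1) * Lmax m f)) as [x [Hx Nx]].
  { apply NNPP; intro K; apply Bf; split; [lia|]; intros _ x Hx.
    apply NNPP; intro; apply K; eauto. }
  apply not_all_ex_not in Nx as [y Ny]; apply imply_to_and in Ny as [Ay Ny].
  exists x, y; split; [auto|split].
  - revert Ay; apply aff_incl; intros z Hz; apply in_drop in Hz; apply in_drop.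
    split; [apply If|]; apply Hz.
  - apply Rnot_le_lt in Ny; rewrite Lf in Ny.
    apply Rlt_le_trans with (1 := Ny), Rmult_le_compat_l; [|apply Lmax_incl; trivial].
    apply Rmult_le_pos; [apply pow_le; lra | apply pos_INR].
Qed.

(** In an edge the altitude equals the length, so its thickness is 1 and it is never bad. *)
Lemma flake_length m Gam tau : 0 < Gam -> Gam <= 1 -> simplex tau -> flake m Gam tau ->
  (3 <= length tau)%nat.
Proof.
  intros HG HG1 St Ft.
  destruct (flake_bad_vertex m Gam tau) as [L [x [y [Hx [Hy D]]]]]; trivial.
  destruct (Nat.eq_dec (length tau) 2) as [E|]; [exfalso|lia].
  destruct St as [_ Nd].
  pose proof (length_drop _ _ Nd Hx) as LD; rewrite E in LD.
  destruct (drop x tau) as [|q [|? ?]] eqn:ED; try easy.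
  assert (y = q) as ->.
  { revert Hy; apply (aff_ind (q :: nil) (fun y => y = q)).
    - now intros v [<-|[]].
    - intros w v z t -> [<-|[]] [<-|[]]; vec; ring. }
  assert (M : Lmax m tau <= dist m x q).
  { assert (I : forall u, In u tau -> u = x \/ u = q).
    { intros u Hu; destruct (veq_dec u x); [now left|right].
      assert (In u (drop x tau)) as K by (apply in_drop; auto).
      rewrite ED in K; now destruct K as [<-|[]]. }
    apply Lmax_le; [apply dist_ge0|]; intros u v Hu Hv.
    pose proof (dist_ge0 m x q).
    destruct (I u Hu) as [->| ->], (I v Hv) as [->| ->];
      rewrite ?dist_refl; try lra; rewrite dist_sym; lra. }
  rewrite E in D; simpl in D; pose proof (Lmax_ge0 m tau); nra.
Qed.

(* Exchange argument: [y = w + t (q - z)] is close to [x], whereas [w] is not, so [t] is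
   not small, and solving for [q] puts it close to [aff (drop q tau)]. *)
Lemma near_aff_exchange m tau x q z y A E L :
  In x tau -> In z tau -> x <> q -> z <> x -> z <> q ->
  aff (drop x tau) y -> dist m x y <= E -> E < A ->
  dist_ge m x (aff (drop x (drop q tau))) A -> dist m q z <= L ->
  exists q', aff (drop q tau) q' /\ dist m q q' * (A - E) <= E * L.
Proof.
  intros Hx Hz Nxq Nzx Nzq Ay Dy EA Hge HL.
  assert (Ay' : aff (q :: drop q (drop x tau)) y).
  { revert Ay; apply aff_incl; intros v Hv.
    destruct (veq_dec v q) as [->|]; [now left|right; apply in_drop; auto]. }
  assert (Hz' : In z (drop q (drop x tau))) by (rewrite !in_drop; auto).
  destruct (aff_cons _ _ _ _ Hz' Ay') as [t [w [Aw ->]]].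
  assert (Aw1 : aff (drop x (drop q tau)) w).
  { revert Aw; apply aff_incl; intros v; rewrite !in_drop; tauto. }
  assert (Aw2 : aff (drop q tau) w).
  { revert Aw; apply aff_incl; intros v; rewrite !in_drop; tauto. }
  pose proof (Hge w Aw1) as H1.
  pose proof (dist_tri m x (vadd w (vscale t (vsub q z))) w) as H2.
  rewrite (dist_sym m (vadd w _) w), dist_shift in H2.
  pose proof (Rabs_pos t); pose proof (dist_ge0 m q z).
  assert (H3 : A - E <= Rabs t * L) by nra.
  assert (H4 : 0 < Rabs t).
  { destruct (Rabs_pos t) as [|K]; trivial; rewrite <- K in H3; lra. }
  assert (Nt : t <> 0) by (intros ->; rewrite Rabs_R0 in H4; lra).
  (* The equation [y = w + t (q - z)] is solved for [q], with [x] put in place of [y]; the error is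
     [(x - y) / t]. *)
  exists (vadd z (vscale (/ t) (vsub x w))); split.
  - apply aff_comb; trivial; apply aff_in, in_drop; auto.
  - set (y := vadd w (vscale t (vsub q z))) in *.
    replace (vadd z (vscale (/ t) (vsub x w))) with (vadd q (vscale (/ t) (vsub x y)))
      by (unfold y; vec; field; trivial).
    rewrite dist_shift, Rabs_inv.
    pose proof (dist_ge0 m x y).
    apply Rle_trans with (/ Rabs t * dist m x y * (Rabs t * L)).
    + apply Rmult_le_compat_l; trivial.
      apply Rmult_le_pos; trivial; apply Rlt_le, Rinv_0_lt_compat; trivial.
    + replace (/ Rabs t * dist m x y * (Rabs t * L)) with (dist m x y * L) by (field; lra).
      apply Rmult_le_compat_r; lra.
Qed.

(** Keeps the flake estimates free of the dimension [k]. *)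
Lemma INR_mul_pow_le1 G k : 0 < G -> G <= 1 / 2 -> INR k * G ^ k <= 1.
Proof.
  intros H0 H1; induction k as [|k IH]; [simpl; lra|].
  rewrite S_INR; simpl.
  assert (P : 0 < G ^ k <= 1).
  { split; [apply pow_lt; trivial|].
    rewrite <- (pow1 k); apply pow_incr; lra. }
  pose proof (pos_INR k); nra.
Qed.

(** The vertices [p] and [q] may coincide; the lemma then gives a vertex other than [p]. *)
Lemma third_vertex tau p q : simplex tau -> (3 <= length tau)%nat -> In p tau -> In q tau ->
  exists z, In z tau /\ z <> p /\ z <> q.
Proof.
  intros [_ Nd] L Hp Hq.
  destruct (drop q (drop p tau)) as [|z l] eqn:E.
  - exfalso; pose proof (length_drop _ _ Nd Hp) as L1.
    destruct (veq_dec q p) as [->|N].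
    + unfold drop in E; rewrite remove_remove_eq in E.
      unfold drop in L1; rewrite E in L1; simpl in L1; lia.
    + assert (Hq' : In q (drop p tau)) by (apply in_drop; auto).
      pose proof (length_drop _ _ (NoDup_drop p _ Nd) Hq') as L2.
      rewrite E in L2; simpl in L2; lia.
  - assert (H : In z (drop q (drop p tau))) by (rewrite E; now left).
    rewrite !in_drop in H; exists z; tauto.
Qed.

Lemma flake_facet m Gam tau q : simplex tau -> flake m Gam tau ->
  (2 <= length tau)%nat -> In q tau -> good m Gam (drop q tau) /\ simplex (drop q tau).
Proof.
  intros [Hn Nd] [_ Hf] L Hq.
  pose proof (length_drop _ _ Nd Hq) as LD.
  assert (S : simplex (drop q tau)).
  { split; [|apply NoDup_drop; trivial].
    intros E; rewrite E in LD; simpl in LD; lia. }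
  split; trivial; apply Hf; [split; trivial|lia].
  intros x Hx; apply in_drop in Hx; tauto.
Qed.

(** The facet opposite [q] is a [k]-simplex of thickness at least [Gam ^ k], and a third vertex
    shows that its longest edge is at least [beta]. *)
Lemma flake_facet_altitude m Gam tau k beta x q :
  0 < Gam -> simplex tau -> flake m Gam tau -> length tau = (k + 2)%nat -> (1 <= k)%nat ->
  separated m tau beta -> In x tau -> In q tau -> x <> q ->
  dist_ge m x (aff (drop x (drop q tau))) (Gam ^ k * INR k * beta).
Proof.
  intros HG St Ft Lt Hk Hsep Hx Hq N y Hy.
  destruct (flake_facet m Gam tau q) as [Gq Sq]; trivial; [lia|].
  pose proof (length_drop _ _ (proj2 St) Hq) as LD.
  assert (Hx' : In x (drop q tau)) by (apply in_drop; auto).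
  destruct (Gq _ (face_refl _ Sq)) as [_ T].
  specialize (T ltac:(lia) x Hx' y Hy).
  replace (length (drop q tau) - 1)%nat with k in T by lia.
  apply Rle_trans with (2 := T), Rmult_le_compat_l.
  - apply Rmult_le_pos; [apply pow_le; lra | apply pos_INR].
  - destruct (third_vertex tau x q) as [z [Hz [Nx Nq]]]; trivial; [lia|].
    apply Rle_trans with (dist m x z); [apply Hsep; auto|].
    apply Lmax_ge; trivial; apply in_drop; auto.
Qed.

(** Put [K = k Gam ^ k] and [L = Lmax m tau]. The bad vertex is within [E = 2 K Gam L] of its
    opposite hull, while its altitude in another facet is at least [A = K beta]. The assumption on
    [beta] gives [E <= 2/7 A], so the exchange bound [E L / (A - E)] is at most
    [14/5 Gam L ^ 2 / beta]: the factor [K] cancels. *)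
Lemma flake_near_facet m Gam tau k beta q :
  0 < Gam -> simplex tau -> flake m Gam tau -> length tau = (k + 2)%nat -> (1 <= k)%nat ->
  0 < beta -> separated m tau beta -> 7 * (Gam * Lmax m tau) <= beta -> In q tau ->
  exists q', aff (drop q tau) q' /\
    dist m q q' * beta <= 14 / 5 * Gam * (Lmax m tau * Lmax m tau).
Proof.
  intros HG St Ft Lt Hk Hb Hsep HL Hq.
  destruct (flake_bad_vertex m Gam tau) as [_ [x [y [Hx [Ay D]]]]]; trivial.
  set (L := Lmax m tau) in *.
  assert (HbL : beta <= L).
  { destruct (third_vertex tau q q) as [z [Hz [Nz _]]]; trivial; [lia|].
    apply Rle_trans with (dist m q z); [apply Hsep; auto | apply Lmax_ge; trivial]. }
  assert (HG7 : Gam <= 1 / 7) by nra.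
  pose proof (INR_mul_pow_le1 Gam k HG ltac:(lra)) as Hk1.
  assert (HINR : 1 <= INR k) by (apply (le_INR 1); trivial).
  pose proof (pow_lt Gam k HG) as HGk.
  replace (length tau - 1)%nat with (S k) in D by lia.
  (* The factor 2 in the next bound comes from [k + 1 <= 2 k]. *)
  rewrite S_INR in D; simpl in D.
  set (K := INR k * Gam ^ k) in *.
  assert (HK : 0 < K) by (apply Rmult_lt_0_compat; lra).
  assert (ED : dist m x y <= 2 * K * (Gam * L)).
  { apply Rlt_le, Rlt_le_trans with (1 := D).
    replace (2 * K * (Gam * L)) with (Gam * Gam ^ k * (2 * INR k) * L) by (unfold K; ring).
    apply Rmult_le_compat_r; [lra|]; apply Rmult_le_compat_l; [nra|lra]. }
  (* If [q] is the bad vertex itself, its own estimate suffices, by [K <= 1] and [beta <= L]. *)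
  destruct (veq_dec x q) as [<-|N].
  - exists y; split; trivial.
    pose proof (dist_ge0 m x y).
    assert (dist m x y <= 2 * (Gam * L)) by nra.
    apply Rle_trans with (2 * (Gam * L) * L); nra.
  - destruct (third_vertex tau x q) as [z [Hz [Nx Nq]]]; trivial; [lia|].
    assert (KB : 2 * K * (Gam * L) <= 2 / 7 * (K * beta)) by nra.
    destruct (near_aff_exchange m tau x q z y (K * beta) (2 * K * (Gam * L)) L)
      as [q' [Aq' Dq']]; trivial; auto.
    + nra.
    + unfold K; rewrite (Rmult_comm (INR k)).
      apply flake_facet_altitude with (Gam := Gam); auto.
    + apply Lmax_ge; trivial.
    + exists q'; split; trivial.
      pose proof (dist_ge0 m q q').
      assert (dist m q q' * (5 / 7 * (K * beta)) <= 2 * K * (Gam * L) * L).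
      { apply Rle_trans with (2 := Dq'), Rmult_le_compat_l; lra. }
      apply Rmult_le_reg_l with (5 / 7 * K); [lra|].
      replace (5 / 7 * K * (dist m q q' * beta))
        with (dist m q q' * (5 / 7 * (K * beta))) by ring.
      replace (5 / 7 * K * (14 / 5 * Gam * (L * L)))
        with (2 * K * (Gam * L) * L) by field.
      trivial.
Qed.

(** * Properties (P1)-(P4) of a forbidden configuration *)

(** The arithmetic behind the hoop constant. With [g = Gam eps / mu], the height [36 g] and the
    deviation [3 g], the right-hand side is at most [512 g eps]; as [2 * 16 ^ 3 = 8192 = 512 * 16],
    the lower bound on [r] turns this into [2 (16 / mu) ^ 3 Gam r ^ 2]. *)
Lemma hoop_radius_bound mu eps Gam r Rad D :
  0 < eps -> 0 < mu -> mu <= 1 -> 0 < Gam -> Gam <= 2 * mu ^ 2 / 75 ->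
  mu * eps / 4 <= r -> r <= Rad -> Rad <= 129 / 100 * eps ->
  D * r <= 36 * (Gam * eps / mu) * r +
    (36 * (Gam * eps / mu) + 3 * (Gam * eps / mu)) *
    (2 * Rad + 36 * (Gam * eps / mu) + 3 * (Gam * eps / mu)) ->
  D <= 2 * (16 / mu) ^ 3 * Gam * r.
Proof.
  intros He Hm Hm1 HG HG2 Hr HrR HR HD.
  set (g := Gam * eps / mu) in *.
  assert (Hmr : 0 < mu * eps) by (apply Rmult_lt_0_compat; trivial).
  assert (Hg : 0 < g) by (unfold g; apply Rdiv_lt_0_compat; nra).
  assert (Egm : g * mu = Gam * eps) by (unfold g; field; lra).
  assert (Hge : g <= 2 / 75 * eps).
  { apply Rmult_le_reg_r with mu; trivial; rewrite Egm.
    assert (mu ^ 2 <= mu) by nra.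
    apply Rle_trans with (2 * mu ^ 2 / 75 * eps); [nra|nra]. }
  assert (HD2 : D * r <= 512 * (g * eps)).
  { apply Rle_trans with (1 := HD); nra. }
  assert (HA : 512 * (g * eps) <= 2 * (16 / mu) ^ 3 * Gam * r * r).
  { replace (2 * (16 / mu) ^ 3 * Gam * r * r)
      with (8192 * Gam / mu ^ 3 * (r * r)) by (field; lra).
    replace (512 * (g * eps)) with (8192 * Gam / mu ^ 3 * ((mu * eps / 4) * (mu * eps / 4)))
      by (unfold g; field; lra).
    apply Rmult_le_compat_l.
    - apply Rlt_le, Rdiv_lt_0_compat; [lra | apply pow_lt; trivial].
    - apply Rmult_le_compat; lra. }
  apply Rmult_le_reg_r with r; lra.
Qed.

(** The given ball circumscribes the common face of the two facets; it is moved to pass through [p]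
    too. The altitude [A] of [p] in the facet opposite [q] satisfies [d <= Gam A], so the centre
    moves by at most [Gam (Rad + d / 2)]. A common vertex [z] compares the radii, and [q] was on the
    old sphere. *)
Lemma flake_shifted_ball m Gam tau k beta p q C Rad d :
  0 < Gam -> simplex tau -> flake m Gam tau -> length tau = (k + 2)%nat -> (1 <= k)%nat ->
  0 < beta -> separated m tau beta -> Forall (InRm m) tau ->
  In p tau -> In q tau -> p <> q ->
  circ_ball m (drop p tau) C Rad -> Rabs (dist m p C - Rad) <= d ->
  d <= Gam ^ (k + 1) * beta ->
  exists C' Rad', circ_ball m (drop q tau) C' Rad' /\
    Rad' <= Rad + Gam * (Rad + d / 2) /\
    Rabs (dist m q C' - Rad') <= 2 * (Gam * (Rad + d / 2)).
Proof.
  intros HG St Ft Lt Hk Hb Hsep HR Hp Hq N HC Hd Hdb.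
  destruct (third_vertex tau p q) as [z [Hz [Np Nq]]]; trivial; [lia|].
  assert (Hz' : In z (drop p (drop q tau))) by (rewrite !in_drop; auto).
  assert (HINR : 1 <= INR k) by (apply (le_INR 1); trivial).
  pose proof (pow_lt Gam k HG) as HGk.
  assert (HC0 : circ_ball m (drop p (drop q tau)) C Rad).
  { revert HC; apply circ_ball_incl; intros v; rewrite !in_drop; tauto. }
  assert (HA : 0 < Gam ^ k * INR k * beta)
    by (apply Rmult_lt_0_compat; trivial; apply Rmult_lt_0_compat; lra).
  destruct (circ_ball_cons m (drop p (drop q tau)) p C Rad d (Gam ^ k * INR k * beta))
    as [C' [Rad' [HC' HD]]]; trivial.
  - intros E; rewrite E in Hz'; easy.
  - apply (proj1 (Forall_forall _ _) HR); trivial.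
  - apply flake_facet_altitude with (Gam := Gam); trivial.
  - exists C', Rad'.
    assert (HR0 : 0 < Rad) by apply HC.
    assert (Hd0 : 0 <= d) by (apply Rle_trans with (2 := Hd), Rabs_pos).
    assert (HS : dist m C C' <= Gam * (Rad + d / 2)).
    { assert (d <= Gam * (Gam ^ k * INR k * beta)).
      { apply Rle_trans with (1 := Hdb); rewrite Nat.add_1_r; simpl.
        assert (0 < Gam * Gam ^ k * beta)
          by (apply Rmult_lt_0_compat; trivial; apply Rmult_lt_0_compat; lra).
        nra. }
      set (A := Gam ^ k * INR k * beta) in *.
      apply Rmult_le_reg_l with (2 * A); [lra|].
      apply Rle_trans with (1 := HD).
      replace (2 * A * (Gam * (Rad + d / 2))) with (Gam * A * (2 * Rad + d)) by field.
      apply Rmult_le_compat_r; lra. }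
    assert (Hzr : dist m C' z = Rad')
      by (apply (circ_ball_dist _ _ _ _ _ HC'); now right).
    assert (Hzc : dist m C z = Rad) by apply (circ_ball_dist _ _ _ _ _ HC0 Hz').
    assert (Hqc : dist m C q = Rad)
      by (apply (circ_ball_dist _ _ _ _ _ HC); apply in_drop; auto).
    pose proof (dist_tri m C' C z) as T1; pose proof (dist_tri m C C' z) as T2.
    pose proof (dist_tri m C' C q) as T3; pose proof (dist_tri m C C' q) as T4.
    rewrite (dist_sym m C' C) in *.
    split; [|split].
    + revert HC'; apply circ_ball_incl; intros v Hv.
      destruct (veq_dec v p) as [->|]; [now left|right; apply in_drop; auto].
    + lra.
    + rewrite (dist_sym m q C'); apply Rabs_le; lra.
Qed.

Lemma forbidden_properties m P' mu eps rho0 Gam delta0 tau :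
  0 < eps -> 0 < mu -> mu <= 1 -> 0 < rho0 -> rho0 <= mu / 4 ->
  0 < Gam -> 0 <= delta0 -> delta0 <= Gam ^ (m + 1) ->
  Gam <= 2 * mu ^ 2 / 75 -> Forall (InRm m) P' -> separated m P' ((mu - 2 * rho0) * eps) ->
  forbidden m P' ((mu - 2 * rho0) / (1 + rho0)) ((1 + rho0) * eps) Gam delta0 tau ->
  hoop m (2 * (16 / mu) ^ 3 * Gam) tau /\
  (forall p, In p tau -> exists c r, circ_min m (drop p tau) c r /\ r < 2 * eps) /\
  Lmax m tau < 5 / 2 * (1 + 1 / 2 * delta0 * mu) * eps /\
  (forall f, facet tau f -> good m Gam f).
Proof.
  intros He Hm Hm1 Hr0 Hr4 HG Hd0 Hd1 HG2 HP Hsep0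
    [St [It [[k [Hkm Lt]] [Ft [p [C [Rad [Hp [HC [HRad Hd]]]]]]]]]].
  assert (Hsep : separated m tau ((mu - 2 * rho0) * eps)).
  { intros x y Hx Hy; apply Hsep0; auto. }
  assert (HR : Forall (InRm m) tau).
  { apply Forall_forall; intros x Hx; apply (proj1 (Forall_forall _ _) HP); auto. }
  (* The product [mu' eps'] is the separation [beta] of the perturbed set. *)
  replace (delta0 * ((mu - 2 * rho0) / (1 + rho0)) * ((1 + rho0) * eps))
    with (delta0 * ((mu - 2 * rho0) * eps)) in Hd by (field; lra).
  set (beta := (mu - 2 * rho0) * eps) in *.
  assert (Hb1 : mu * eps / 2 <= beta) by (unfold beta; nra).
  assert (Hb2 : beta <= mu * eps) by (unfold beta; nra).
  assert (Hme : 0 < mu * eps <= eps) by (split; nra).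
  assert (Hm2 : 0 < mu ^ 2 <= mu) by (split; [apply pow_lt; trivial | simpl; nra]).
  assert (HG75 : Gam <= 2 / 75) by lra.
  pose proof (flake_length m Gam tau HG ltac:(lra) St Ft) as L3.
  assert (Hk : (1 <= k)%nat) by lia.
  assert (Hmono : forall i j, (i <= j)%nat -> Gam ^ j <= Gam ^ i).
  { intros i j Hij; replace j with (i + (j - i))%nat by lia; rewrite pow_add.
    pose proof (pow_lt Gam i HG).
    assert (Gam ^ (j - i) <= 1) by (rewrite <- (pow1 (j - i)); apply pow_incr; lra).
    nra. }
  assert (HdG : delta0 <= Gam).
  { rewrite <- (pow_1 Gam); apply Rle_trans with (1 := Hd1), Hmono; lia. }
  (* Here [k <= m] matters: [Gam ^ (m + 1) <= Gam ^ (k + 1)]. *)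
  assert (HdK : delta0 * beta <= Gam ^ (k + 1) * beta).
  { apply Rmult_le_compat_r; [lra|]; apply Rle_trans with (1 := Hd1), Hmono; lia. }
  assert (HdE : 0 <= delta0 * beta <= Gam * eps) by (split; nra).
  assert (HRad' : Rad < 5 / 4 * eps) by nra.
  assert (HR0 : 0 < Rad) by apply HC.
  assert (HCp : forall x, In x tau -> x <> p -> dist m C x = Rad).
  { intros x Hx Nx; apply (circ_ball_dist _ _ _ _ _ HC), in_drop; auto. }
  (* Only [p] can be off the sphere, so the slack counts once for each pair of vertices. *)
  assert (HL1 : Lmax m tau <= 2 * Rad + delta0 * beta).
  { assert (Hxc : forall x, In x tau -> dist m C x <= Rad + delta0 * beta).
    { intros x Hx; destruct (veq_dec x p) as [->|N].
      - rewrite dist_sym; revert Hd; unfold Rabs; destruct (Rcase_abs _); lra.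
      - rewrite HCp; trivial; lra. }
    apply Lmax_le; [lra|]; intros x y Hx Hy.
    destruct (veq_dec x y) as [->|N]; [rewrite dist_refl; lra|].
    pose proof (dist_tri m x C y) as T; rewrite (dist_sym m x C) in T.
    pose proof (Hxc x Hx); pose proof (Hxc y Hy).
    destruct (veq_dec x p) as [->|Nx].
    - rewrite (HCp y) in T; auto; lra.
    - rewrite (HCp x) in T; auto; lra. }
  (* Twice [5/4] plus the slack [2/75] is below [253/100]. *)
  assert (HL2 : Lmax m tau <= 253 / 100 * eps) by nra.
  pose proof (Lmax_ge0 m tau) as HL0.
  assert (HGL : 7 * (Gam * Lmax m tau) <= beta).
  { assert (Gam * Lmax m tau <= 2 / 75 * mu * (253 / 100 * eps))
      by (apply Rmult_le_compat; lra).
    lra. }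
  set (g := Gam * eps / mu).
  assert (Egm : g * mu = Gam * eps) by (unfold g; field; lra).
  assert (Hg : 0 < g) by (unfold g; apply Rdiv_lt_0_compat; nra).
  assert (Hge : Gam * eps <= g) by nra.
  assert (Key : forall q, In q tau -> exists c r, circ_min m (drop q tau) c r /\
    r < 2 * eps /\ exists z, circsphere m (drop q tau) c r z /\
      dist m q z <= 2 * (16 / mu) ^ 3 * Gam * r).
  { intros q Hq.
    destruct (flake_near_facet m Gam tau k beta q) as [q' [Aq' Dq']]; trivial; [lra|].
    (* From [14/5 * 2.53 ^ 2 < 18] and [beta >= mu eps / 2]. *)
    assert (Hh : dist m q q' <= 36 * g).
    { apply Rmult_le_reg_r with beta; [lra|]; apply Rle_trans with (1 := Dq').
      apply Rle_trans with (14 / 5 * Gam * (253 / 100 * eps * (253 / 100 * eps))).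
      - apply Rmult_le_compat_l; [lra|]; apply Rmult_le_compat; lra.
      - apply Rle_trans with (36 * g * (mu * eps / 2)).
        + replace (36 * g * (mu * eps / 2)) with (18 * (g * mu) * eps) by field.
          rewrite Egm; assert (0 < Gam * eps * eps) by (repeat apply Rmult_lt_0_compat; lra).
          nra.
        + apply Rmult_le_compat_l; lra. }
    assert (exists C' Rad', circ_ball m (drop q tau) C' Rad' /\ Rad' <= 129 / 100 * eps /\
      Rabs (dist m q C' - Rad') <= 3 * g) as [C' [Rad' [HC' [HR' Hd']]]].
    (* For [q = p] the given ball already works, its deviation being at most [Gam eps <= g];
       otherwise it is shifted. *)
    { destruct (veq_dec p q) as [<-|N].
      - exists C, Rad; split; [|split]; trivial; lra.
      - assert (HX : Gam * (Rad + delta0 * beta / 2) <= 127 / 100 * (Gam * eps)).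
        { replace (127 / 100 * (Gam * eps)) with (Gam * (127 / 100 * eps)) by ring.
          apply Rmult_le_compat_l; nra. }
        destruct (flake_shifted_ball m Gam tau k beta p q C Rad (delta0 * beta))
          as [C' [Rad' [H1 [H2 H3]]]]; trivial; [lra|].
        exists C', Rad'; split; [|split]; trivial; [|lra].
        nra. }
    (* Two vertices of the facet, at least [mu eps / 2] apart, give [r >= mu eps / 4]. *)
    destruct (third_vertex tau q q) as [x1 [Hx1 [N1 _]]]; trivial.
    destruct (third_vertex tau q x1) as [x2 [Hx2 [N2 N12]]]; trivial.
    destruct (near_circsphere m (drop q tau) C' Rad' x1 x2 q q' (36 * g) (3 * g))
      as [c [r [Hmin [Hr [HrR [Hr2 [z [Hz HD]]]]]]]]; auto; try (apply in_drop; auto).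
    exists c, r; split; [|split]; trivial; [lra|].
    exists z; split; trivial.
    apply hoop_radius_bound with (eps := eps) (Rad := Rad'); trivial.
    pose proof (Hsep x1 x2 Hx1 Hx2 (not_eq_sym N12)); lra. }
  split; [|split; [|split]].
  - intros q Hq; destruct (Key q Hq) as [c [r [Hmin [_ [z [Hz HD]]]]]].
    exists c, r; split; trivial; intros e Hpos; exists z; split; trivial; lra.
  - intros q Hq; destruct (Key q Hq) as [c [r [Hmin [Hr _]]]]; eauto.
  - apply Rle_lt_trans with (1 := HL1).
    assert (delta0 * beta <= delta0 * (mu * eps)) by (apply Rmult_le_compat_l; lra).
    assert (0 <= delta0 * (mu * eps)) by (apply Rmult_le_pos; lra).
    nra.
  - intros f [Ff Lf]; apply Ft; trivial; lia.
Qed.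

(** * Linear dependence and separation *)

Lemma lincomb_cons a l v s : lincomb (a :: l) (v :: s) = vadd (vscale a v) (lincomb l s).
Proof. easy. Qed.

Lemma lincomb_app l1 s1 l2 s2 : length l1 = length s1 ->
  lincomb (l1 ++ l2) (s1 ++ s2) = vadd (lincomb l1 s1) (lincomb l2 s2).
Proof.
  revert s1; induction l1 as [|a l1 IH]; intros [|v s1]; try easy; intros L.
  - simpl; unfold lincomb at 2; simpl; vec; ring.
  - simpl app; rewrite !lincomb_cons, IH by (simpl in L; lia); vec; ring.
Qed.

(** For a linear functional [f], the map [x - f(x) v] is linear, hence commutes with combinations.
    It is the elimination step below, both for linear dependence and for Farkas' lemma. *)
Lemma lincomb_map_shear (f : Vec -> R) (v : Vec) s l :
  f vzero = 0 -> (forall a x y, f (vadd (vscale a x) y) = a * f x + f y) ->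
  lincomb l (map (fun x => vsub x (vscale (f x) v)) s) =
  vsub (lincomb l s) (vscale (f (lincomb l s)) v).
Proof.
  intros F0 F; revert l; induction s as [|w s IH]; intros [|a l];
    try (unfold lincomb; simpl; rewrite F0; vec; ring).
  simpl map; rewrite !lincomb_cons, IH, F; vec; ring.
Qed.

Lemma sum_app l1 l2 :
  fold_right Rplus 0 (l1 ++ l2) = fold_right Rplus 0 l1 + fold_right Rplus 0 l2.
Proof. induction l1; simpl; [ring | rewrite IHl1; ring]. Qed.

Lemma split_at_length {T} n (l : list T) : (n <= length l)%nat ->
  exists l1 l2, l = l1 ++ l2 /\ length l1 = n.
Proof.
  intros H; exists (firstn n l), (skipn n l).
  rewrite firstn_skipn, length_firstn; split; trivial; lia.
Qed.

Lemma lincomb_coord_zero i l s : (forall v, In v s -> v i = 0) -> lincomb l s i = 0.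
Proof.
  revert l; induction s as [|v s IH]; intros [|a l] H; try easy.
  rewrite lincomb_cons; unfold vadd, vscale; rewrite IH, H; [ring|now left|].
  intros; apply H; now right.
Qed.

(** Gaussian elimination on coordinate [n]: a pivot [v] clears it from the other vectors, and a
    dependence among these extends to [v]. Without a pivot the coordinate vanishes throughout. *)
Lemma linear_dependence n : forall s, (n < length s)%nat ->
  exists l, length l = length s /\ (exists a, In a l /\ a <> 0) /\
    forall i, (i < n)%nat -> lincomb l s i = 0.
Proof.
  induction n as [|n IH]; intros s L.
  - exists (repeat 1 (length s)); rewrite repeat_length; split; [easy|split; [|lia]].
    exists 1; split; [|lra]; destruct s; simpl in *; [lia | now left].
  - destruct (classic (exists v, In v s /\ v n <> 0)) as [[v [Hv Nv]]|N].
    + apply in_split in Hv as [s1 [s2 ->]].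
      set (f := fun x : Vec => x n / v n).
      rewrite length_app in L; simpl in L.
      destruct (IH (map (fun x => vsub x (vscale (f x) v)) (s1 ++ s2)))
        as [l [Ll [[a [Ia Na]] Z]]]; [rewrite length_map, length_app; lia|].
      rewrite length_map, length_app in Ll.
      assert (F0 : f vzero = 0) by (unfold f, vzero; field; trivial).
      assert (F1 : forall a x y, f (vadd (vscale a x) y) = a * f x + f y)
        by (intros; unfold f, vadd, vscale; field; trivial).
      rewrite (lincomb_map_shear f v (s1 ++ s2) l F0 F1) in Z.
      destruct (split_at_length (length s1) l) as [l1 [l2 [-> L1]]]; [lia|].
      rewrite length_app in Ll.
      exists (l1 ++ - f (lincomb (l1 ++ l2) (s1 ++ s2)) :: l2); split; [|split].
      * rewrite !length_app; simpl; lia.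
      * exists a; split; trivial; apply in_app_iff in Ia; apply in_app_iff; simpl; tauto.
      * assert (E : lincomb (l1 ++ - f (lincomb (l1 ++ l2) (s1 ++ s2)) :: l2) (s1 ++ v :: s2)
          = vsub (lincomb (l1 ++ l2) (s1 ++ s2))
              (vscale (f (lincomb (l1 ++ l2) (s1 ++ s2))) v)).
        { rewrite lincomb_app, lincomb_cons by trivial.
          rewrite (lincomb_app l1 s1 l2 s2) by trivial; vec; ring. }
        intros i Hi; rewrite E.
        destruct (Nat.eq_dec i n) as [->|]; [|apply Z; lia].
        unfold f, vsub, vscale; field; trivial.
    + destruct (IH s) as [l [Ll [Ha Z]]]; [lia|].
      exists l; split; [|split]; trivial; intros i Hi.
      destruct (Nat.eq_dec i n) as [->|]; [|apply Z; lia].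
      apply lincomb_coord_zero; intros v Hv; apply NNPP; intro; apply N; eauto.
Qed.

(** The lift to height 1 in dimension [m + 1]: the new coordinate of a combination records the sum
    of its weights, so affine statements become linear ones. *)
Definition homogenize (m : nat) (x : Vec) : Vec := fun i => if Nat.eqb i m then 1 else x i.

Lemma lincomb_homogenize_lt m l s i : (i < m)%nat ->
  lincomb l (map (homogenize m) s) i = lincomb l s i.
Proof.
  intros Hi; revert l; induction s as [|v s IH]; intros [|a l]; try easy.
  simpl map; rewrite !lincomb_cons; unfold vadd, vscale; rewrite IH.
  unfold homogenize at 1; rewrite (proj2 (Nat.eqb_neq i m)); [easy|lia].
Qed.

Lemma lincomb_homogenize_eq m l s : length l = length s ->
  lincomb l (map (homogenize m) s) m = fold_right Rplus 0 l.
Proof.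
  revert s; induction l as [|a l IH]; intros [|v s]; try easy; intros L.
  simpl map; rewrite !lincomb_cons; unfold vadd, vscale; rewrite IH by (simpl in L; lia).
  unfold homogenize at 1; rewrite Nat.eqb_refl; simpl; ring.
Qed.

Lemma InRm_lincomb m l s : Forall (InRm m) s -> InRm m (lincomb l s).
Proof.
  intros H i Hi; apply lincomb_coord_zero; intros v Hv.
  apply (proj1 (Forall_forall _ _) H v Hv); trivial.
Qed.

Lemma lincomb_opp_div a l s :
  lincomb (map (fun b => - b / a) l) s = vscale (- / a) (lincomb l s).
Proof.
  revert l; induction s as [|v s IH]; intros [|b l];
    try (unfold lincomb; simpl; vec; ring).
  simpl map; rewrite !lincomb_cons, IH; vec; unfold Rdiv; ring.
Qed.

Lemma sum_opp_div a l :
  fold_right Rplus 0 (map (fun b => - b / a) l) = - / a * fold_right Rplus 0 l.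
Proof. induction l; simpl; [ring | rewrite IHl; unfold Rdiv; ring]. Qed.

(** The lifted points are linearly dependent; the relation is solved for a point [x] with nonzero
    coefficient [a]. The weights sum to 0, so the quotients [- b / a] over the other points sum to
    1. *)
Lemma affine_dependence m s : NoDup s -> Forall (InRm m) s -> (m + 1 < length s)%nat ->
  exists x, In x s /\ aff (drop x s) x.
Proof.
  intros Nd HR L.
  destruct (linear_dependence (m + 1) (map (homogenize m) s)) as [l [Ll [[a [Ia Na]] Z]]];
    [rewrite length_map; trivial|].
  rewrite length_map in Ll.
  pose proof (Z m ltac:(lia)) as Zm; rewrite lincomb_homogenize_eq in Zm by trivial.
  assert (Z0 : lincomb l s = vzero).
  { apply functional_extensionality; intro i; unfold vzero.
    destruct (Nat.lt_ge_cases i m) as [Hi|Hi].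
    - rewrite <- (lincomb_homogenize_lt m) by trivial; apply Z; lia.
    - apply (InRm_lincomb m); trivial. }
  apply in_split in Ia as [l1 [l2 ->]].
  rewrite length_app in Ll; simpl in Ll.
  destruct (split_at_length (length l1) s) as [s1 [s2' [-> L1]]]; [lia|].
  rewrite length_app in Ll.
  destruct s2' as [|x s2]; [simpl in Ll; lia|]; simpl in Ll.
  exists x; split; [apply in_app_iff; right; now left|].
  rewrite sum_app in Zm; simpl in Zm.
  rewrite lincomb_app, lincomb_cons in Z0 by lia.
  assert (A : aff (s1 ++ s2) x).
  { exists (map (fun b => - b / a) (l1 ++ l2)); split; [|split].
    - rewrite length_map, !length_app; lia.
    - rewrite sum_opp_div, sum_app.
      replace (fold_right Rplus 0 l1 + fold_right Rplus 0 l2) with (- a) by lra.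
      field; trivial.
    - rewrite lincomb_opp_div, lincomb_app by lia.
      apply functional_extensionality; intro i; apply (f_equal (fun h => h i)) in Z0.
      unfold vadd, vscale, vzero in *.
      replace (lincomb l1 s1 i + lincomb l2 s2 i) with (- a * x i) by lra.
      field; trivial. }
  revert A; apply aff_incl; intros u Hu; apply NoDup_remove in Nd as [_ Nx].
  apply in_drop; split; [|now intros ->].
  apply in_app_iff in Hu; apply in_app_iff; simpl; tauto.
Qed.

(** * Cones, convex hulls and separating hyperplanes *)

Lemma dot_lincomb_le m u c l s : length l = length s -> Forall (fun a => 0 <= a) l ->
  (forall v, In v s -> dot m u v <= c) ->
  dot m u (lincomb l s) <= fold_right Rplus 0 l * c.
Proof.
  revert s; induction l as [|a l IH]; intros [|v s]; try easy; intros L F H.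
  - unfold lincomb; simpl; rewrite dot_zeror; lra.
  - inversion F; subst; rewrite lincomb_cons; dots; simpl fold_right.
    assert (dot m u (lincomb l s) <= fold_right Rplus 0 l * c).
    { apply IH; trivial; [simpl in L; lia|]; intros; apply H; now right. }
    assert (dot m u v <= c) by (apply H; now left).
    nra.
Qed.

(** Farkas' lemma by induction on the number of generators. If [u] separates [b] from the cone of
    [s] but is positive on [v], everything is projected along [v] onto the hyperplane orthogonal to
    [u], and the induction hypothesis is used again. *)
Lemma farkas m : forall n s b, length s = n ->
  (exists l, length l = length s /\ Forall (fun a => 0 <= a) l /\
     forall i, (i < m)%nat -> lincomb l s i = b i) \/
  (exists u, (forall v, In v s -> dot m u v <= 0) /\ 0 < dot m u b).
Proof.
  induction n as [|n IH]; intros s b L.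
  - destruct s; [|easy].
    destruct (dot_pos m b) as [P|Z].
    + right; exists b; split; [easy|trivial].
    + left; exists nil; split; [easy|split; [easy|]]; intros i Hi.
      rewrite (dot_self_eq0 m b (eq_sym Z) i Hi); easy.
  - destruct s as [|v s]; [easy|]; simpl in L.
    destruct (IH s b) as [[l [Ll [Fl El]]]|[u [Hu Hb]]]; [lia| |].
    + left; exists (0 :: l); split; [simpl; lia|split].
      * constructor; trivial; lra.
      * intros i Hi; rewrite lincomb_cons; unfold vadd, vscale; rewrite El; trivial; ring.
    + destruct (Rle_lt_dec (dot m u v) 0) as [Hv|Hv].
      { right; exists u; split; trivial; intros w [<-|Hw]; auto. }
      set (f := fun x => dot m u x / dot m u v).
      set (pr := fun x => vsub x (vscale (f x) v)).
      assert (Pr : forall x, dot m u (pr x) = 0)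
        by (intro x; unfold pr, f; dots; field; lra).
      destruct (IH (map pr s) (pr b)) as [[l [Ll [Fl El]]]|[u' [Hu' Hb']]];
        [rewrite length_map; lia| |].
      * left; rewrite length_map in Ll.
        unfold pr in El; rewrite lincomb_map_shear in El.
        2:{ unfold f; rewrite dot_zeror; field; lra. }
        2:{ intros; unfold f; dots; field; lra. }
        (* The coefficient of [v] undoes the projection; it is nonnegative because [u] is positive
           on [b] and nonpositive on [s]. *)
        exists (f b - f (lincomb l s) :: l); split; [simpl; lia|split].
        -- constructor; trivial.
           assert (dot m u (lincomb l s) <= fold_right Rplus 0 l * 0)
             by (apply dot_lincomb_le; trivial).
           unfold f, Rdiv; rewrite <- Rmult_minus_distr_r.
           apply Rmult_le_pos; [lra | apply Rlt_le, Rinv_0_lt_compat; trivial].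
        -- intros i Hi; specialize (El i Hi); rewrite lincomb_cons.
           unfold vadd, vsub, vscale in *; lra.
      (* This vector represents [u'] composed with [pr]; it vanishes on [v]. *)
      * right; exists (vsub u' (vscale (dot m u' v / dot m u v) u)).
        assert (E : forall x, dot m (vsub u' (vscale (dot m u' v / dot m u v) u)) x =
                       dot m u' (pr x)).
        { intro x; unfold pr, f; dots; field; lra. }
        split.
        -- intros w [<-|Hw].
           ++ dots; apply Req_le; field; lra.
           ++ rewrite E; apply Hu', in_map; trivial.
        -- rewrite E; trivial.
Qed.

Lemma dot_homogenize m u x : dot (m + 1) u (homogenize m x) = dot m u x + u m.
Proof.
  unfold dot; rewrite seq_app, map_app, sum_app; simpl.
  unfold homogenize at 2; rewrite Nat.eqb_refl.
  replace (map (fun i => u i * homogenize m x i) (seq 0 m))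
    with (map (fun i => u i * x i) (seq 0 m)); [ring|].
  apply map_ext_in; intros i Hi; apply in_seq in Hi.
  unfold homogenize; rewrite (proj2 (Nat.eqb_neq i m)); [easy|lia].
Qed.

(** Farkas' lemma for the lifted points: a nonnegative combination equal to the lift of [y] has
    total weight 1, and in the other case coordinate [m] of [u] is the offset of the hyperplane. *)
Lemma conv_separation m s y : Forall (InRm m) s -> InRm m y -> ~ conv s y ->
  exists u, forall p, In p s -> dot m u p < dot m u y.
Proof.
  intros Hs Hy N.
  destruct (farkas (m + 1) _ (map (homogenize m) s) (homogenize m y) eq_refl)
    as [[l [Ll [Fl El]]]|[u [Hu Hb]]].
  - exfalso; apply N; rewrite length_map in Ll; exists l; split; [|split;[|split]]; trivial.
    + rewrite <- (lincomb_homogenize_eq m l s), El by (trivial; lia).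
      unfold homogenize; rewrite Nat.eqb_refl; easy.
    + apply functional_extensionality; intro i.
      destruct (Nat.lt_ge_cases i m) as [Hi|Hi].
      * rewrite <- (lincomb_homogenize_lt m), El by (trivial; lia).
        unfold homogenize; rewrite (proj2 (Nat.eqb_neq i m)); [easy|lia].
      * rewrite (Hy i Hi); symmetry; apply (InRm_lincomb m); trivial.
  - exists u; intros p Hp; rewrite dot_homogenize in Hb.
    specialize (Hu _ (in_map (homogenize m) _ _ Hp)); rewrite dot_homogenize in Hu; lra.
Qed.

Lemma conv_dot_le m u c s x : conv s x -> (forall p, In p s -> dot m u p <= c) ->
  dot m u x <= c.
Proof.
  intros [l [L [F [E ->]]]] H.
  pose proof (dot_lincomb_le m u c l s L F H) as K; rewrite E in K; lra.
Qed.

Lemma conv_InRm m s x : Forall (InRm m) s -> conv s x -> InRm m x.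
Proof. intros H [l [_ [_ [_ ->]]]]; apply InRm_lincomb; trivial. Qed.

(** The boundary point sits at the supremum [t] of the parameters whose points lie in [A].
    Parameters in [A] come arbitrarily close to [t], and none exceeds it; if [t = 1], the endpoint
    [y] is outside. *)
Lemma bdry_on_segment m (A : Vec -> Prop) x y : InRm m x -> InRm m y -> A x -> ~ A y ->
  exists b, bdry m A b /\ dist m x b <= dist m x y.
Proof.
  intros Hx Hy Ax Ay.
  set (pt := fun t => vadd x (vscale t (vsub y x))).
  set (T := fun t => 0 <= t <= 1 /\ A (pt t)).
  assert (P0 : pt 0 = x) by (unfold pt; vec; ring).
  assert (P1 : pt 1 = y) by (unfold pt; vec; ring).
  assert (HP : forall t, InRm m (pt t)) by (intro; apply InRm_shift; trivial).
  assert (HD : forall a b, dist m (pt a) (pt b) = Rabs (b - a) * dist m x y).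
  { intros a b; replace (pt b) with (vadd (pt a) (vscale (b - a) (vsub y x)))
      by (unfold pt; vec; ring).
    rewrite dist_shift, (dist_sym m y x); easy. }
  assert (T0 : T 0) by (split; [lra | rewrite P0; trivial]).
  destruct (completeness T) as [t [Ub Lub]].
  { exists 1; intros a [Ha _]; lra. }
  { exists 0; trivial. }
  assert (Ht0 : 0 <= t) by (apply Ub; trivial).
  assert (Ht1 : t <= 1) by (apply Lub; intros a [Ha _]; lra).
  exists (pt t); split.
  - split; [apply HP|]; intros r Hr.
    set (D := dist m x y) in *.
    assert (D0 : 0 <= D) by apply dist_ge0.
    set (e := r / (D + 1)).
    assert (He : 0 < e) by (apply Rdiv_lt_0_compat; lra).
    assert (HeD : e * D < r).
    { apply Rlt_le_trans with (e * (D + 1)); [nra|].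
      unfold e; apply Req_le; field; lra. }
    split.
    + destruct (classic (exists a, T a /\ t - e < a)) as [[a [Ta Ha]]|N].
      * exists (pt a); split; [apply HP|split]; [|apply Ta].
        rewrite HD; apply Rle_lt_trans with (2 := HeD), Rmult_le_compat_r; trivial.
        specialize (Ub a Ta); apply Rabs_le; lra.
      * exfalso; enough (t <= t - e) by lra; apply Lub; intros a Ta.
        apply Rnot_lt_le; intro; apply N; eauto.
    + destruct Ht1 as [Ht1| ->].
      * set (a := Rmin 1 (t + e)).
        assert (Ha : t < a <= 1 /\ a <= t + e).
        { unfold a; repeat split; [|apply Rmin_l|apply Rmin_r].
          apply Rmin_glb_lt; lra. }
        exists (pt a); split; [apply HP|split].
        -- rewrite HD; apply Rle_lt_trans with (2 := HeD), Rmult_le_compat_r; trivial.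
           apply Rabs_le; lra.
        -- intro K; assert (T a) as Ta by (split; trivial; lra).
           specialize (Ub a Ta); lra.
      * exists (pt 1); split; [apply HP|split].
        -- rewrite dist_refl; trivial.
        -- rewrite P1; trivial.
  - rewrite <- P0 at 1; rewrite HD, Rminus_0_r, Rabs_pos_eq by trivial.
    pose proof (dist_ge0 m x y); nra.
Qed.

(** * Perturbed nets *)

Lemma perturbation_separated m P P' rho0 eps d :
  separated m P d -> perturbation m P P' rho0 eps -> separated m P' (d - 2 * (rho0 * eps)).
Proof.
  intros Hsep [_ [zeta [Hp Hz]]] p' q' Ip Iq N.
  apply (Permutation_in _ Hp), in_map_iff in Ip as [p [<- Ip]].
  apply (Permutation_in _ Hp), in_map_iff in Iq as [q [<- Iq]].
  assert (Npq : p <> q) by (intros ->; easy).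
  pose proof (Hsep p q Ip Iq Npq); pose proof (Hz p Ip); pose proof (Hz q Iq).
  pose proof (dist_tri m p (zeta p) q); pose proof (dist_tri m (zeta p) (zeta q) q).
  rewrite (dist_sym m p (zeta p)) in *; lra.
Qed.

(* If a point within [eps] of [x] were outside [conv P], shifting it by slightly more than
   [rho0 * eps] along the normal of a separating hyperplane would leave [conv P']. *)
Lemma perturbation_dense m P P' rho0 eps x :
  finite_set m P -> 0 < eps -> 0 < rho0 -> eps_dense m P eps ->
  perturbation m P P' rho0 eps -> D_eps m P' ((1 + rho0) * eps) x ->
  exists p', In p' P' /\ dist m x p' < (1 + rho0) * eps.
Proof.
  intros [_ HP] He Hr Hden [[_ HP'] [zeta [Hperm Hz]]] [Cx Bx].
  assert (Hx : InRm m x) by exact (conv_InRm _ _ _ HP' Cx).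
  assert (Iz : forall p, In p P -> In (zeta p) P').
  { intros p Hp; apply (Permutation_in _ (Permutation_sym Hperm)), in_map; trivial. }
  assert (Ball : forall y, InRm m y -> dist m x y < eps -> conv P y).
  { intros y Hy Dy; apply NNPP; intro N.
    destruct (conv_separation m P y HP Hy N) as [u0 Hu0].
    (* Coordinates from [m] on are cut off so that a shift along [u] stays in the space. *)
    set (u := fun i => if Nat.ltb i m then u0 i else 0).
    assert (Ru : InRm m u).
    { intros i Hi; unfold u; rewrite (proj2 (Nat.ltb_ge i m)); trivial. }
    assert (Du : forall v, dot m u v = dot m u0 v).
    { intro v; unfold dot; f_equal; apply map_ext_in; intros i Hi; apply in_seq in Hi.
      unfold u; rewrite (proj2 (Nat.ltb_lt i m)); [easy|lia]. }
    assert (Hu : forall p, In p P -> dot m u p < dot m u y)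
      by (intros p Hp; rewrite !Du; auto).
    assert (exists p, In p P) as [p0 Hp0].
    { destruct P as [|p0 P0]; [|exists p0; now left].
      apply Permutation_sym, Permutation_nil in Hperm; subst P'.
      destruct Cx as [[|? ?] [L [_ [E _]]]]; simpl in *; [lra|easy]. }
    assert (Np : 0 < norm m u).
    { destruct (norm_ge0 m u) as [K|K]; trivial; exfalso.
      pose proof (norm_sqr m u) as E; rewrite <- K in E.
      pose proof (cauchy_schwarz m u (vsub y p0)) as S; rewrite <- E in S.
      specialize (Hu p0 Hp0); rewrite dot_subr in S; nra. }
    (* This shift exceeds [rho0 * eps], which puts [z] outside [conv P'], and stays below
       [(1 + rho0) * eps - dist m x y], which keeps [z] too near [x] for a boundary point to lie
       between them. *)
    set (e := rho0 * eps + (eps - dist m x y) / 2).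
    assert (Hre : 0 < rho0 * eps) by (apply Rmult_lt_0_compat; trivial).
    set (z := vadd y (vscale (e / norm m u) (vsub u vzero))).
    assert (Hzz : InRm m z) by (apply InRm_shift; trivial; easy).
    assert (Ez : dot m u z = dot m u y + e * norm m u).
    { unfold z; dots; rewrite dot_zeror, <- (norm_sqr m u); field; lra. }
    assert (Dz : dist m y z = e).
    { unfold z; rewrite dist_shift; unfold dist at 1.
      replace (vsub u vzero) with u by (vec; ring).
      rewrite Rabs_pos_eq; [field; lra|].
      apply Rlt_le, Rdiv_lt_0_compat; trivial; unfold e; lra. }
    assert (Nz : ~ conv P' z).
    { intros Cz.
      enough (K : dot m u z <= dot m u y + rho0 * eps * norm m u)
        by (rewrite Ez in K; unfold e in K; nra).
      apply (conv_dot_le m u _ P' z Cz); intros p' Ip'.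
      apply (Permutation_in _ Hperm), in_map_iff in Ip' as [p [<- Ip]].
      pose proof (dot_le_norm m u (vsub (zeta p) p)) as S; rewrite dot_subr in S.
      specialize (Hz p Ip); unfold dist in Hz; specialize (Hu p Ip).
      nra. }
    destruct (bdry_on_segment m (conv P') x z) as [b [Hb Db]]; trivial.
    specialize (Bx b Hb); pose proof (dist_tri m x y z); unfold e in Dz; lra. }
  assert (CxP : conv P x) by (apply Ball; trivial; rewrite dist_refl; trivial).
  destruct (Hden x CxP) as [y [[Iy|By] Dy]].
  - exists (zeta y); split; auto.
    pose proof (dist_tri m x y (zeta y)) as T; rewrite (dist_sym m y (zeta y)) in T.
    specialize (Hz y Iy); lra.
  (* The open ball of radius [eps] about [x] lies in [conv P], so it contains no boundary point. *)
  - exfalso; destruct By as [_ By].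
    destruct (By (eps - dist m x y)) as [_ [z [Hz' [Dz Nz]]]]; [lra|].
    apply Nz, Ball; trivial; pose proof (dist_tri m x y z); lra.
Qed.

(** * Delaunay balls, goodness and protection *)

(** Positivity of the radius comes from a vertex on the boundary: points of the ball lie near it, so
    the ball is nonempty. *)
Lemma del_ball_circ m P s c r : s <> nil -> del_ball_of m P s c r -> circ_ball m s c r.
Proof.
  intros Hs [[Hc _] Hb]; split; [|split]; trivial.
  destruct s as [|v s]; [easy|].
  destruct (Hb v) as [_ K]; [now left|].
  destruct (K 1) as [[y [_ [_ [_ L]]]] _]; [lra|].
  pose proof (dist_ge0 m c y); lra.
Qed.

Lemma not_good_of_affine_dependence m Gam s x :
  0 < Gam -> simplex s -> Forall (InRm m) s -> (2 <= length s)%nat ->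
  In x s -> aff (drop x s) x -> ~ good m Gam s.
Proof.
  intros HG Ss HR L2 Hx Ax Hg.
  destruct (Hg s (face_refl _ Ss)) as [_ T].
  specialize (T L2 x Hx x Ax); rewrite dist_refl in T.
  pose proof (length_drop x s (proj2 Ss) Hx) as LD.
  destruct (drop x s) as [|z l] eqn:E; [simpl in LD; lia|].
  assert (Hz : In z (drop x s)) by (rewrite E; now left).
  apply in_drop in Hz as [Hz Nz].
  assert (HRx := proj1 (Forall_forall _ _) HR).
  pose proof (dist_pos m x z (HRx x Hx) (HRx z Hz) (not_eq_sym Nz)).
  pose proof (Lmax_ge m s x z Hx Hz).
  assert (0 < Gam ^ (length s - 1)) by (apply pow_lt; trivial).
  assert (0 < INR (length s - 1)) by (apply lt_0_INR; lia).
  assert (0 < Gam ^ (length s - 1) * INR (length s - 1) * Lmax m s)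
    by (repeat apply Rmult_lt_0_compat; lra).
  lra.
Qed.

(* A [delta]-violation of protection adds a nearly cospherical point [q]; the [m + 2] points
   [q :: s] are affinely dependent, hence contain a flake. *)
Lemma good_protected_of_no_forbidden m P' mu' eps' Gam delta0 s c r :
  0 < Gam -> Gam <= 1 -> 0 <= delta0 * mu' * eps' -> Forall (InRm m) P' ->
  (forall tau, ~ forbidden m P' mu' eps' Gam delta0 tau) ->
  simplex s -> incl s P' -> length s = (m + 1)%nat ->
  del_ball_of m P' s c r -> r < eps' ->
  good m Gam s /\ protected m P' (delta0 * mu' * eps') s.
Proof.
  intros HG HG1 Hd HP Hforb Ss Is Ls HB Hr.
  assert (HC : circ_ball m s c r) by (apply (del_ball_circ m P'); trivial; apply Ss).
  assert (Hgood : good m Gam s).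
  { apply NNPP; intro Nb.
    destruct (flake_exists m Gam s Ss Nb) as [f [[Sf If] Ff]].
    pose proof (flake_length m Gam f HG HG1 Sf Ff).
    pose proof (NoDup_incl_length (proj2 Sf) If).
    (* Any vertex can play the distinguished [p]: all of them lie on the Delaunay sphere, so the
       deviation is 0. *)
    destruct f as [|p f']; [simpl in *; lia|].
    apply (Hforb (p :: f')); split; [|split;[|split;[|split]]]; trivial.
    - intros x Hx; auto.
    - exists (length (p :: f') - 2)%nat; lia.
    - exists p, c, r; split; [now left|split; [|split]]; trivial.
      + revert HC; apply circ_ball_incl; intros x Hx; apply in_drop in Hx; apply If; tauto.
      + rewrite dist_sym, (circ_ball_dist _ _ _ _ _ HC) by (apply If; now left).
        rewrite Rminus_diag, Rabs_R0; trivial. }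
  split; trivial; exists c, r; split; trivial; intros q Hq Nq.
  assert (HRq := proj1 (Forall_forall _ _) HP).
  assert (Hqr : r <= dist m c q).
  { apply Rnot_lt_le; intro K; apply (proj1 (proj2 (proj1 HB)) q Hq); split; auto. }
  assert (Hlt : delta0 * mu' * eps' < dist m c q - r).
  { apply Rnot_le_lt; intro K.
    assert (Sq : simplex (q :: s)) by (split; [easy | constructor; trivial; apply Ss]).
    assert (HRs : Forall (InRm m) (q :: s)).
    { constructor; [auto|]; apply Forall_forall; auto. }
    assert (Nb : ~ good m Gam (q :: s)).
    { destruct (affine_dependence m (q :: s)) as [x [Hx Ax]]; trivial.
      { apply Sq. }
      { simpl; lia. }
      apply (not_good_of_affine_dependence m Gam (q :: s) x); trivial; simpl; lia. }
    destruct (flake_exists m Gam _ Sq Nb) as [f [[Sf If] Ff]].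
    (* A flake avoiding [q] would be a bad face of the good simplex [s]. With [q] in it, the
       remaining vertices lie on the Delaunay sphere. *)
    assert (Iq : In q f).
    { apply NNPP; intro N; apply (proj1 Ff), (good_face m Gam s); trivial.
      split; trivial; intros x Hx; destruct (If x Hx) as [<-|]; tauto. }
    pose proof (flake_length m Gam f HG HG1 Sf Ff).
    pose proof (NoDup_incl_length (proj2 Sf) If) as Lf; simpl in Lf.
    apply (Hforb f); split; [|split;[|split;[|split]]]; trivial.
    - intros x Hx; destruct (If x Hx) as [<-|]; auto.
    - exists (length f - 2)%nat; lia.
    - exists q, c, r; split; [|split; [|split]]; trivial.
      + revert HC; apply circ_ball_incl; intros x Hx; apply in_drop in Hx as [Hx Nx].
        destruct (If x Hx) as [<-|]; tauto.
      + rewrite dist_sym, Rabs_pos_eq; lra. }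
  exists (dist m c q - r - delta0 * mu' * eps'); split; [lra|].
  intros y Hy; apply bdry_ball_dist in Hy.
  pose proof (dist_tri m c y q) as T; rewrite (dist_sym m y q) in T; lra.
Qed.

Theorem mainTheorem11 (m : nat) (P P' : list Vec) (mu eps rho0 Gam delta0 : R) :
  net m P mu eps ->
  0 < rho0 -> rho0 <= mu / 4 ->
  perturbation m P P' rho0 eps ->
  0 < Gam -> Gam <= 1 ->
  0 <= delta0 -> delta0 <= Gam ^ (m + 1) ->
  Gam <= 2 * mu ^ 2 / 75 ->
  (forall tau, simplex tau -> incl tau P' ->
     ~ ( hoop m (2 * (16 / mu) ^ 3 * Gam) tau /\
         (forall p, In p tau -> exists c r, circ_min m (drop p tau) c r /\ r < 2 * eps) /\
         Lmax m tau < 5 / 2 * (1 + 1 / 2 * delta0 * mu) * eps /\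
         (forall f, facet tau f -> good m Gam f))) ->
  let eps' := (1 + rho0) * eps in
  let mu' := (mu - 2 * rho0) / (1 + rho0) in
  (forall tau, ~ forbidden m P' mu' eps' Gam delta0 tau) /\
  (forall s, Del_D m P' eps' s -> length s = (m + 1)%nat ->
     good m Gam s /\ protected m P' (delta0 * mu' * eps') s).
Proof.
  intros [HfP [He [Hmu [Hmu1 [Hden Hsep]]]]] Hr0 Hr4 Hper HG HG1 Hd0 Hd1 HG2 Hno eps' mu'.
  assert (HP' : Forall (InRm m) P') by apply (proj1 Hper).
  assert (Hsep' : separated m P' ((mu - 2 * rho0) * eps)).
  { replace ((mu - 2 * rho0) * eps) with (mu * eps - 2 * (rho0 * eps)) by ring.
    exact (perturbation_separated m P P' rho0 eps _ Hsep Hper). }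
  assert (Hforb : forall tau, ~ forbidden m P' mu' eps' Gam delta0 tau).
  { intros tau Ht; apply (Hno tau); [apply Ht | apply Ht |].
    exact (forbidden_properties m P' mu eps rho0 Gam delta0 tau
             He Hmu Hmu1 Hr0 Hr4 HG Hd0 Hd1 HG2 HP' Hsep' Ht). }
  split; trivial.
  intros s [Ss [Is [c [r [HB HD]]]]] Ls.
  apply good_protected_of_no_forbidden with (c := c) (r := r); trivial.
  - assert (0 < eps') by (apply Rmult_lt_0_compat; lra).
    assert (0 < mu') by (apply Rdiv_lt_0_compat; lra).
    apply Rmult_le_pos; [apply Rmult_le_pos|]; lra.
  (* Some point of [P'] is closer than [eps'] to the centre, and the Delaunay ball is empty, so its
     radius is less than [eps']. *)
  - destruct (perturbation_dense m P P' rho0 eps c) as [p [Ip Dp]]; trivial.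
    apply Rle_lt_trans with (2 := Dp), Rnot_lt_le; intro K.
    apply (proj1 (proj2 (proj1 HB)) p Ip); split; trivial.
    exact (proj1 (Forall_forall _ _) HP' p Ip).
Qed.
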